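(* There is an absolute constant $c$ (independent of $n$ and of the distribution of $X$) such that for every integer $n \ge 2$ and every random vector $X$ in $\mathbb{R}^n$ with $\mathbb{E}|X|^2 = n$, $$ \mathbb{E}_\theta\, \rho(F_\theta,\Phi) \, \leq \, c\,\big(M_2^2 + \sigma_2\big)\,\frac{\log n}{\sqrt{n}} . $$
   Context: $|\cdot|$ and $\langle\cdot,\cdot\rangle$ are the Euclidean norm and inner product on $\mathbb{R}^n$. $S^{n-1}=\{\theta\in\mathbb{R}^n: |\theta|=1\}$, $\mu_{n-1}$ is the uniform (rotation-invariant) probability measure on $S^{n-1}$, and $\mathbb{E}_\theta$ denotes integration over $\theta\in S^{n-1}$ with respect to $\mu_{n-1}$. For $\theta\in S^{n-1}$, $S_\theta=\langle X,\theta\rangle=\theta_1X_1+\dots+\theta_nX_n$ and $F_\theta(x)=\mathbb{P}\{S_\theta\le x\}$, $x\in\mathbb{R}$. $\Phi(x)=\frac{1}{\sqrt{2\pi}}\int_{-\infty}^x e^{-y^2/2}\,dy$ is the standard normal distribution function. For distribution functions $U,V$ on $\mathbb{R}$, $\rho(U,V)=\sup_{x\in\mathbb{R}}|U(x)-V(x)|$ (Kolmogorov distance). Finally $$M_2=\sup_{\theta\in S^{n-1}}\big(\mathbb{E}\langle X,\theta\rangle^2\big)^{1/2},\qquad \sigma_2=\sqrt{n}\;\mathbb{E}\,\Big|\frac{|X|^2}{n}-1\Big|=\frac{1}{\sqrt n}\,\mathbb{E}\,\big||X|^2-n\big|.$$ *)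

(* Defs.v *)
From HB Require Import structures.
From mathcomp Require Import all_boot all_order all_algebra.
From mathcomp Require Import all_classical all_reals all_analysis.
From mathcomp Require Import measurable_realfun.
Set Implicit Arguments.
Unset Strict Implicit.
Unset Printing Implicit Defensive.
Import Order.TTheory GRing.Theory Num.Theory.
Import numFieldNormedType.Exports.
Local Open Scope classical_set_scope.
Local Open Scope ring_scope.

(* R^n is n.-tuple R, whose library sigma-algebra is generated by the
   coordinates, i.e. is the Borel sigma-algebra. *)

Definition inner (R : realType) (n : nat) (x y : n.-tuple R) : R :=
  \sum_(i < n) tnth x i * tnth y i.

Definition enorm (R : realType) (n : nat) (x : n.-tuple R) : R :=
  Num.sqrt (inner x x).

Definition sphere (R : realType) (n : nat) : set (n.-tuple R) :=
  [set x | enorm x = 1].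
Arguments sphere R n : clear implicits.

Definition mxact (R : realType) (n : nat) (O : 'M[R]_n) (x : n.-tuple R)
    : n.-tuple R :=
  [tuple \sum_(j < n) O i j * tnth x j | i < n].

(* For n >= 1 exactly one probability measure satisfies this predicate, the
   uniform measure on the sphere, seen as a measure on R^n. *)
Definition uniform_sphere (R : realType) (n : nat)
    (mu : probability (n.-tuple R) R) : Prop :=
  mu (sphere R n) = 1%E /\
  forall (O : 'M[R]_n) (A : set (n.-tuple R)),
    O *m O^T = 1%:M -> measurable A -> mu (mxact O @^-1` A) = mu A.

Lemma measurable_innerl (R : realType) (n : nat) (theta : n.-tuple R) :
  measurable_fun [set: n.-tuple R] (fun x => inner x theta).
Proof.
apply: measurable_sum => i.
by apply: measurable_funM => //; exact: measurable_tnth.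
Qed.

Section WeightedSums.
Context (R : realType) (n : nat) (d : measure_display) (T : measurableType d).
Context (P : probability T R) (X : {RV P >-> n.-tuple R}).
Local Open Scope ereal_scope.

Definition wsum (theta : n.-tuple R) : T -> R := fun w => inner (X w) theta.

Lemma measurable_wsum (theta : n.-tuple R) :
  measurable_fun [set: T] (wsum theta).
Proof.
exact: (measurableT_comp (measurable_innerl theta) (measurable_funPT X)).
Qed.

HB.instance Definition _ (theta : n.-tuple R) :=
  isMeasurableFun.Build _ _ _ _ (wsum theta) (measurable_wsum theta).

Definition F_ (theta : n.-tuple R) : R -> \bar R :=
  cdf (wsum theta : {RV P >-> R}).

(* Suprema and moments are taken in \bar R, so that no finiteness has to be
   known beforehand and no default value occurs. *)
Definition M2 : \bar R :=
  ereal_sup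
    [set 'E_P[fun w => (inner (X w) theta ^+ 2)%R] `^ 2^-1
      | theta in sphere R n].

Definition sigma2 : \bar R :=
  (Num.sqrt n%:R)%:E * 'E_P[fun w => `| enorm (X w) ^+ 2 / n%:R - 1 |%R].

End WeightedSums.

Definition Phi (R : realType) (x : R) : \bar R := normal_prob 0 1 `]-oo, x].

Definition kolmogorov_dist (R : realType) (U V : R -> \bar R) : \bar R :=
  ereal_sup (range (fun x : R => `| U x - V x |%E)).

(* Main.v *)
(** Averaged Fourier argument, carried out with real functions only.  Take a
    standard Gaussian vector g independent of theta; by rotation invariance
    H = |g| theta / sqrt n has E cos <z, H> = exp (- |z|^2 / 2n) for every z,
    so that all averages over H are explicit and, as |g|^2 / n is within
    O(n^-1/2) of 1 on average, theta may be traded for H.  For fixed H, compare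
    S = <X, H> with a normal variable after convolution with N(0, s^2),
    s ~ 1/n: by Fourier inversion the smoothed Kolmogorov distance is at most
    the integral of exp (- s^2 t^2 / 2) |f_H(t) - exp (- t^2 / 2)| / t, f_H being
    the characteristic function of S restricted to {|X|^2 >= n/2}.  With Y an
    independent copy of X, E_H |f_H(t) - exp (- t^2 / 2)|^2 is the expectation of
    exp (- t^2 (|X|^2 + |Y|^2) / 2n) (exp (t^2 <X, Y> / n) - 1) + (bias)^2,
    hence O(min (1, t^2) (M_2^2 / n + sigma_2^2 / n)): the linear term is
    t^2 |E X exp (- t^2 |X|^2 / 2n)|^2 / n, and the rest is controlled by
    E <X, Y>^2 <= n M_2^2.  Integrating min (1, t) / t up to 1/s ~ n yields the
    factor log n. *)
Require Import Defs.
From HB Require Import structures.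
From mathcomp Require Import all_boot all_order all_algebra.
From mathcomp Require Import all_classical all_reals all_analysis.
From mathcomp Require Import measurable_realfun ring lra.
Set Implicit Arguments.
Unset Strict Implicit.
Unset Printing Implicit Defensive.
Import Order.TTheory GRing.Theory Num.Theory.
Import numFieldNormedType.Exports.
Local Open Scope classical_set_scope.
Local Open Scope ring_scope.

(** * Integration *)

(** The Fourier bound for fixed H does not involve x, so the supremum over x is taken before
    averaging and only the mean over H remains to be estimated. H replaces theta because the
    spherical mean of cos <z, theta> is a Bessel-type function, Gaussian only approximately, while
    for H it is exactly Gaussian. The restriction to |X|^2 >= n/2 keeps the damping exp (- t^2 |X|^2
    / 2n) below exp (- t^2 / 4), which beats the powers of t produced by Taylor expansion; the
    discarded event has probability at most 2 sigma_2 / sqrt n. The linear term t^2 <X, Y> / n has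
    to be integrated with its sign, since E |<X, Y>| / n is in general only O(M_2 / sqrt n). The
    square root of the variance is of order (M_2 + sigma_2) / sqrt n, and E |X|^2 = n forces M_2 >=
    1, which leads to M_2^2. Normal tails are bounded by Chebyshev's inequality alone; a shift by s
    v with s <= 1/n and v = sqrt n then costs 1/n + O(n^-1/2). *)

Section expectation.
Context d (T : measurableType d) (R : realType) (P : probability T R).

Lemma bounded_integrable (f : T -> R) (M : R) : measurable_fun [set: T] f ->
  (forall x, `|f x| <= M) -> P.-integrable [set: T] (EFin \o f).
Proof.
move=> mf fM; apply: measurable_bounded_integrable => //.
  by rewrite -ge0_fin_numE // fin_num_measure.
exists M; split; first exact: num_real.
by move=> x Mx y _ /=; rewrite (le_trans (fM y))// ltW.
Qed.

Lemma Rexpectation_cst (r : R) : \int[P]_x r = r.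
Proof. by rewrite Rintegral_cst//= (@probability_setT _ _ _ P) mulr1. Qed.

Lemma integrable_cstR (r : R) : P.-integrable [set: T] (EFin \o cst r).
Proof. by apply: (@bounded_integrable _ `|r|). Qed.

Lemma le_integrableR (f g : T -> R) : measurable_fun [set: T] f ->
  (forall x, `|f x| <= g x) -> P.-integrable [set: T] (EFin \o g) ->
  P.-integrable [set: T] (EFin \o f).
Proof.
move=> mf fg; apply: le_integrable => //; first exact/measurable_EFinP.
by move=> x _ /=; rewrite lee_fin (le_trans (fg x))// ler_norm.
Qed.

End expectation.

Section real_integrable.
Context d (T : measurableType d) (R : realType) (mu : {measure set T -> \bar R}).
Implicit Types f g : T -> R.

Lemma integrableRZ (c : R) f : mu.-integrable setT (EFin \o f) ->
  mu.-integrable setT (EFin \o (fun x => c * f x)).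
Proof. by move=> /(integrableZl measurableT c); exact: eq_integrable. Qed.

Lemma integrableRD f g : mu.-integrable setT (EFin \o f) ->
  mu.-integrable setT (EFin \o g) ->
  mu.-integrable setT (EFin \o (fun x => f x + g x)).
Proof. by move=> If Ig; apply: eq_integrable (integrableD measurableT If Ig). Qed.

Lemma integrableRB f g : mu.-integrable setT (EFin \o f) ->
  mu.-integrable setT (EFin \o g) ->
  mu.-integrable setT (EFin \o (fun x => f x - g x)).
Proof. by move=> If Ig; apply: eq_integrable (integrableB measurableT If Ig). Qed.

End real_integrable.

(** The integral of a nonnegative function is a supremum over the simple functions below it, hence
    monotone for arbitrary functions. This matters for the map from theta to the Kolmogorov
    distance, a supremum over uncountably many points. *)
Lemma ge0_le_integral_nomeas d (T : measurableType d) (R : realType)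
    (mu : {measure set T -> \bar R}) (D : set T) (f g : T -> \bar R) :
  (forall x, D x -> (0 <= f x)%E) -> (forall x, D x -> (f x <= g x)%E) ->
  (\int[mu]_(x in D) f x <= \int[mu]_(x in D) g x)%E.
Proof.
move=> f0 fg.
have g0 x : D x -> (0 <= g x)%E by move=> Dx; exact: le_trans (f0 _ Dx) (fg _ Dx).
have f'0 x : (0 <= (f \_ D) x)%E by apply: erestrict_ge0.
have g'0 x : (0 <= (g \_ D) x)%E by apply: erestrict_ge0.
rewrite (integral_mkcond D f) (integral_mkcond D g) !ge0_integralTE//.
apply: ereal_sup_le => _ [h hf <-]; exists h => // x.
by rewrite (le_trans (hf x))//; apply: lee_restrict.
Qed.

Section Rfubini.
Context d1 d2 (T1 : measurableType d1) (T2 : measurableType d2) (R : realType).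
Variables (P : probability T1 R) (Q : probability T2 R) (f : T1 * T2 -> R).
Hypothesis intf : (P \x Q)%E.-integrable setT (EFin \o f).
Hypothesis intf1 : forall x, Q.-integrable setT (EFin \o (fun y => f (x, y))).
Hypothesis intf2 : forall y, P.-integrable setT (EFin \o (fun x => f (x, y))).

(** Integrability of every section, and not just of almost every one, ensures that no inner real
    integral falls back on the default value of [fine]. *)
Lemma Rfubini1 : \int[P]_x \int[Q]_y f (x, y) = \int[(P \x Q)%E]_z f z.
Proof.
congr fine; rewrite -(integral12_prod_meas1 intf).
apply: eq_integral => x _; rewrite /fubini_F /Rintegral fineK// integrable_fin_num//; exact: intf1.
Qed.

Lemma Rfubini2 : \int[Q]_y \int[P]_x f (x, y) = \int[(P \x Q)%E]_z f z.
Proof.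
congr fine; rewrite -(integral21_prod_meas1 intf).
apply: eq_integral => x _; rewrite /fubini_G /Rintegral fineK// integrable_fin_num//; exact: intf2.
Qed.

Lemma Rfubini :
  \int[P]_x \int[Q]_y f (x, y) = \int[Q]_y \int[P]_x f (x, y).
Proof. by rewrite Rfubini1 Rfubini2. Qed.

Lemma integrable_Rfubini1 : P.-integrable setT (EFin \o (fun x => \int[Q]_y f (x, y))).
Proof.
apply: eq_integrable (integrable_fubini_F intf) => // x _.
by rewrite /fubini_F /= /Rintegral fineK// integrable_fin_num//; exact: intf1.
Qed.

Lemma integrable_Rfubini2 : Q.-integrable setT (EFin \o (fun y => \int[P]_x f (x, y))).
Proof.
have mf : measurable_fun setT (EFin \o f) by exact: measurable_int intf.
have E y : (\int[P]_x f (x, y))%:E = fubini_G P (EFin \o f) y.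
  by rewrite /fubini_G /= /Rintegral fineK// integrable_fin_num//; exact: intf2.
apply/integrableP; split.
  rewrite (_ : EFin \o _ = fubini_G P (EFin \o f)); first exact: measurable_fubini_G intf.
  by apply/funext => y /=; rewrite E.
apply: le_lt_trans ((integrable21ltyP P Q mf).1 intf).
apply: ge0_le_integral_nomeas => y _; first exact: abse_ge0.
rewrite [X in (`|X| <= _)%E]E.
apply: le_abse_integral => //; exact: measurable_int (intf2 y).
Qed.

End Rfubini.

Section Rfubini_bounded.
Context d1 d2 (T1 : measurableType d1) (T2 : measurableType d2) (R : realType).
Variables (P : probability T1 R) (Q : probability T2 R) (f : T1 * T2 -> R) (M : R).
Hypothesis mf : measurable_fun setT f.
Hypothesis fM : forall z, `|f z| <= M.

Lemma bounded_fubini_hyp :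
  [/\ (P \x Q)%E.-integrable setT (EFin \o f),
   forall x, Q.-integrable setT (EFin \o (fun y => f (x, y))) &
   forall y, P.-integrable setT (EFin \o (fun x => f (x, y)))].
Proof.
split.
- exact: bounded_integrable fM.
- move=> x; apply: (@bounded_integrable _ _ _ Q _ M) => //.
  exact: (measurableT_comp mf (pair1_measurable x)).
- move=> y; apply: (@bounded_integrable _ _ _ P _ M) => //.
  exact: (measurableT_comp mf (pair2_measurable y)).
Qed.

Lemma Rfubini_bounded1 : \int[P]_x \int[Q]_y f (x, y) = \int[(P \x Q)%E]_z f z.
Proof. by have [? ? ?] := bounded_fubini_hyp; exact: Rfubini1. Qed.

Lemma Rfubini_bounded :
  \int[P]_x \int[Q]_y f (x, y) = \int[Q]_y \int[P]_x f (x, y).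
Proof. by have [? ? ?] := bounded_fubini_hyp; exact: Rfubini. Qed.

End Rfubini_bounded.

(** * The standard normal law *)

Lemma normal_coef_le1 (R : realType) : (Num.sqrt (pi *+ 2))^-1 <= 1 :> R.
Proof.
have pi1 : 1 <= @pi R *+ 2 by rewrite mulr2n; have := @pi_ge2 R; lra.
rewrite invf_le1 ?sqrtr_gt0 ?(lt_le_trans _ pi1)//.
by rewrite -[leLHS]sqrtr1 ler_wsqrtr.
Qed.

Section density.
Context (R : realType).
Notation mu := (@lebesgue_measure R).
Notation gauss := (@normal_prob R 0 1).
Notation pdf := (@normal_pdf R 0 1).

(** Change of variables is phrased with the Radon-Nikodym derivative; it agrees almost everywhere
    with the density because both have the same integral over every measurable set. *)
Lemma ge0_integral_normal (f : R -> \bar R) :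
  (forall x, 0 <= f x)%E -> measurable_fun setT f ->
  (\int[gauss]_x f x = \int[mu]_x (f x * (pdf x)%:E))%E.
Proof.
move=> f0 mf.
rewrite -(Radon_Nikodym_SigmaFinite.change_of_variables (normal_prob_dominates 0 1))//.
have dom := @normal_prob_dominates R 0 1.
have iRN := Radon_Nikodym_SigmaFinite.f_integrable dom.
apply: ae_eq_integral => //.
- apply: emeasurable_funM => //; exact: measurable_int iRN.
- apply: emeasurable_funM => //; apply/measurable_EFinP; exact: measurable_normal_pdf.
- apply: ae_eqe_mul2l; apply: integral_ae_eq => //.
  + by apply/measurable_EFinP; exact: measurable_normal_pdf.
  + by move=> E _ mE; rewrite -Radon_Nikodym_SigmaFinite.f_integral.
Qed.

Lemma normal_pdf01 (x : R) : pdf x = (Num.sqrt (pi *+ 2))^-1 * expR (- (x ^+ 2) / 2).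
Proof.
by rewrite normal_pdfE ?oner_eq0// /normal_peak /normal_fun expr1n mul1r subr0.
Qed.

Lemma integrable_normal (f : R -> R) : measurable_fun setT f ->
  gauss.-integrable setT (EFin \o f) <->
  mu.-integrable setT (EFin \o (fun x => f x * pdf x)).
Proof.
move=> mf.
have mfp : measurable_fun setT (fun x => f x * pdf x).
  by apply: measurable_funM => //; exact: measurable_normal_pdf.
have E : (\int[gauss]_x `|(f x)%:E| = \int[mu]_x `|(f x * pdf x)%:E|)%E.
  rewrite ge0_integral_normal//; last exact/measurable_EFinP/measurableT_comp.
  by apply: eq_integral => x _ /=; rewrite normrM (ger0_norm (normal_pdf_ge0 _ _ _)).
split => /integrableP [_ h]; apply/integrableP; split => //.
- exact/measurable_EFinP.
- by rewrite /= -E.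
- exact/measurable_EFinP.
- by rewrite /= E.
Qed.

Lemma Rintegral_normal (f : R -> R) : gauss.-integrable setT (EFin \o f) ->
  \int[gauss]_x f x = \int[mu]_x (f x * pdf x).
Proof.
move=> intf.
have mf : measurable_fun setT f by apply/measurable_EFinP; exact: measurable_int intf.
congr fine; rewrite [LHS]integralE [RHS]integralE; congr (_ - _)%E.
- rewrite ge0_integral_normal//; last exact/measurable_funepos/measurable_EFinP.
  apply: eq_integral => x _; rewrite !funeposE /= -!EFin_max -EFinM.
  by rewrite maxr_pMl ?mul0r ?normal_pdf_ge0.
- rewrite ge0_integral_normal//; last exact/measurable_funeneg/measurable_EFinP.
  apply: eq_integral => x _; rewrite !funenegE /= -?EFinN -!EFin_max -?EFinM.
  by rewrite maxr_pMl ?mul0r ?normal_pdf_ge0// mulNr.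
Qed.

(** Length times a bound for the density. With [r = 0] this is a Lipschitz estimate;
    [r = x ^+ 2 / 4] serves to compare the normal law at [x] and at a multiple of [x]. *)
Lemma normal_itv_le (x y r : R) : x <= y ->
  (forall z, x <= z <= y -> r <= z ^+ 2) ->
  (gauss `[x, y] <= ((y - x) * expR (- r / 2))%:E)%E.
Proof.
move=> xy zr; rewrite /normal_prob.
apply: (@le_trans _ _ (\int[mu]_(z in `[x, y]) (expR (- r / 2))%:E)%E).
  apply: ge0_le_integral_nomeas => z.
    by move=> _; rewrite lee_fin normal_pdf_ge0.
  rewrite /= in_itv/= => /zr rz; rewrite lee_fin normal_pdf01.
  rewrite -[leRHS]mul1r ler_pM ?expR_ge0 ?invr_ge0 ?sqrtr_ge0//.
    exact: normal_coef_le1.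
  by rewrite ler_expR; lra.
rewrite integral_cst//= lebesgue_measure_itv/=; case: ifP => [_|].
  by rewrite -EFinB -EFinM mulrC.
by move=> _; rewrite mule0 lee_fin mulr_ge0 ?expR_ge0// subr_ge0.
Qed.

End density.

(** * Moments, Stein's identity and the characteristic function of the normal law *)

Section moments.
Context (R : realType).
Notation mu := (@lebesgue_measure R).
Notation gauss := (@normal_prob R 0 1).
Notation pdf := (@normal_pdf R 0 1).

Lemma derivable_everywhere_FTC2 (F f : R -> R) (a b : R) : a <= b ->
  (forall x, is_derive x (1 : R) F (f x)) -> continuous f ->
  (\int[mu]_(x in `[a, b]) (f x)%:E = (F b - F a)%:E)%E.
Proof.
move=> ab dF cf.
have cF : continuous F.
  by move=> x; apply: differentiable_continuous; apply/derivable1_diffP; case: (dF x).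
move: ab; rewrite le_eqVlt => /predU1P[->|ab].
  by rewrite set_itv1 integral_set1 subrr.
rewrite (@continuous_FTC2 R f F)//.
- exact: continuous_subspaceT.
- split.
  + by move=> x _; case: (dF x).
  + apply: cvg_at_right_filter; exact: cF.
  + apply: cvg_at_left_filter; exact: cF.
- by move=> x _; rewrite derive1E; case: (dF x).
Qed.

(** Fundamental theorem of calculus on the intervals [-n, n], followed by dominated convergence. *)
Lemma integral_derive_vanishing (F f : R -> R) :
  (forall x, is_derive x (1 : R) F (f x)) -> continuous f ->
  mu.-integrable setT (EFin \o f) ->
  F n%:R @[n --> \oo] --> (0 : R) -> F (- n%:R) @[n --> \oo] --> (0 : R) ->
  \int[mu]_x f x = 0.
Proof.
move=> dF cf intf Fp Fn.
have mf : measurable_fun setT f by exact: continuous_measurable_fun.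
pose D n : set R := `[- (n%:R : R), n%:R]%classic.
pose f_ n := (EFin \o f) \_ (D n).
have [] := @dominated_convergence _ _ R mu setT measurableT f_ (EFin \o f) (abse \o (EFin \o f)).
- move=> n; apply/(measurable_restrictT _ _).1; first exact: measurable_itv.
  by apply/measurable_EFinP; exact: measurable_funTS.
- exact/measurable_EFinP.
- apply: aeW => x _; apply: cvg_near_cst; near=> n.
  rewrite /f_ patchE ifT// /D inE/= in_itv/= -ler_norml.
  by near: n; exact: nbhs_infty_ger.
- exact: integrable_abse.
- apply: aeW => x n _; rewrite /f_ patchE; case: ifP => // _.
  by rewrite abse0 abse_ge0.
move=> _ _.
have -> : [sequence (\int[mu]_x f_ n x)%E]_n = (fun n => (F n%:R - F (- n%:R))%:E).
  apply/funext => n /=; rewrite -integral_mkcond.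
  by rewrite (@derivable_everywhere_FTC2 F)// ge0_cp.
move=> h.
have : (fun n => (F n%:R - F (- n%:R))%:E) @ \oo --> (0 - 0 : R)%:E.
  by apply: cvg_EFin; [exact: nearW|exact: cvgB].
by rewrite subr0 => /(cvg_unique _ h); rewrite /Rintegral => ->.
Unshelve. all: by end_near. Qed.

(** As exp (x^2 / 8) >= x^2 / 8, its square exp (x^2 / 4) is at least x^4 / 64. *)
Lemma expR_sqr4 (x : R) : x ^+ 4 * expR (- x ^+ 2 / 4) <= 64.
Proof.
have h : x ^+ 4 <= 64 * expR (x ^+ 2 / 4).
  have -> : x ^+ 2 / 4 = x ^+ 2 / 8 + x ^+ 2 / 8 by field.
  rewrite expRD.
  have := expR_ge1Dx (x ^+ 2 / 8); set e := expR _ => e1.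
  have -> : x ^+ 4 = (x ^+ 2 / 8) ^+ 2 * 64 by field.
  have : 0 <= x ^+ 2 / 8 by rewrite divr_ge0// sqr_ge0.
  move: (x ^+ 2 / 8) e1 => y e1 y0.
  have := sqr_ge0 (e - y); nra.
rewrite mulNr expRN -ler_pdivlMr ?invr_gt0 ?expR_gt0// invrK.
exact: h.
Qed.

(** x^4 exp (- x^2 / 2) is dominated by 64 exp (- x^2 / 4), a multiple of the normal density of
    variance 2. *)
Lemma integrable_normal4 : gauss.-integrable setT (EFin \o (fun x => x ^+ 4)).
Proof.
apply/integrable_normal; first exact: measurable_funX.
have s2 : Num.sqrt 2 != 0 :> R by rewrite gt_eqF// sqrtr_gt0.
have := @integrable_normal_pdf R 0 (Num.sqrt 2).
move=> /(integrableZl measurableT (64 / normal_peak (Num.sqrt 2))).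
apply: le_integrable => //.
  apply/measurable_EFinP; apply: measurable_funM; first exact: measurable_funX.
  exact: measurable_normal_pdf.
move=> x _ /=; rewrite lee_fin normal_pdf01 normal_pdfE// /normal_fun subr0.
rewrite sqr_sqrtr// [X in _ <= `|X|]mulrA divfK ?gt_eqF ?normal_peak_gt0//.
have x40 : 0 <= x ^+ 4 by exact: exprn_even_ge0.
have K0 : 0 <= (Num.sqrt (pi *+ 2))^-1 :> R by rewrite invr_ge0 sqrtr_ge0.
rewrite ger0_norm; last by apply: mulr_ge0 => //; apply: mulr_ge0 => //; exact: expR_ge0.
rewrite ger0_norm; last by rewrite mulr_ge0 ?expR_ge0.
have -> : - x ^+ 2 / 2 = - x ^+ 2 / 4 + - x ^+ 2 / 4 by field.
have -> : - x ^+ 2 / (2 *+ 2) = - x ^+ 2 / 4 by congr (_ / _); rewrite mulr2n; lra.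
rewrite expRD; have := expR_sqr4 x.
have p1 := normal_coef_le1 R.
set e := expR _ => h; have e0 : 0 <= e by exact: expR_ge0.
rewrite [X in X <= _](_ : _ = (Num.sqrt (pi *+ 2))^-1 * (x ^+ 4 * e * e)); last by ring.
apply: (@le_trans _ _ (1 * (x ^+ 4 * e * e))).
  by apply: ler_wpM2r => //; apply: mulr_ge0 => //; exact: mulr_ge0.
by rewrite mul1r ler_wpM2r.
Qed.

Lemma integrable_normal_le4 (f : R -> R) (c : R) : measurable_fun setT f ->
  (forall x, `|f x| <= c * (1 + x ^+ 4)) -> gauss.-integrable setT (EFin \o f).
Proof.
move=> mf fc; apply: (@le_integrableR _ _ _ gauss f (fun x => c * (1 + x ^+ 4))) => //.
apply: integrableRZ; apply: integrableRD; last exact: integrable_normal4.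
exact: (integrable_cstR gauss).
Qed.

End moments.

Lemma is_derive_Rintegral d (T : measurableType d) (R : realType)
    (P : {measure set T -> \bar R}) (f f' : R -> T -> R) (G : T -> R) (a : R) :
  (forall x y, is_derive x (1 : R) (f ^~ y) (f' x y)) ->
  (forall x, P.-integrable setT (EFin \o f x)) ->
  (forall x y, `|f' x y| <= G y) -> P.-integrable setT (EFin \o G) ->
  is_derive a (1 : R) (fun x => \int[P]_y f x y) (\int[P]_y f' a y).
Proof.
move=> df intf f'G intG.
have G0 y : 0 <= G y by exact: le_trans (normr_ge0 _) (f'G 0 y).
have Ia : a \in `]a - 1, a + 1[ by rewrite in_itv/=; apply/andP; split; lra.
have E x y : partial1of2 f x y = f' x y by rewrite partial1of2E; case: (df x y).
have df1 x y : derivable (f ^~ y) x 1 by case: (df x y).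
have lG x y : `|partial1of2 f x y| <= G y by rewrite E.
apply: DeriveDef.
  by apply: (derivable_under_integral measurableT Ia (fun x _ => intf x)
    (fun x y _ _ => df1 x y) G0 intG (fun x y _ _ => lG x y)).
rewrite -derive1E (differentiation_under_integral measurableT Ia (fun x _ => intf x)
    (fun x y _ _ => df1 x y) G0 intG (fun x y _ _ => lG x y)).
by apply: eq_Rintegral => y _; rewrite E.
Qed.

Section stein.
Context (R : realType).
Notation mu := (@lebesgue_measure R).
Notation gauss := (@normal_prob R 0 1).
Notation pdf := (@normal_pdf R 0 1).

Lemma is_derive_normal_pdf (x : R) : is_derive x (1 : R) pdf (- x * pdf x).
Proof.
have -> : pdf = (fun x => (Num.sqrt (pi *+ 2))^-1 * expR (- (x ^+ 2) / 2)).
  by apply/funext => y; rewrite normal_pdf01.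
have d1 : is_derive x (1 : R) (fun y : R => - (y ^+ 2) / 2) (- x).
  have := is_deriveZ (- 2^-1 : R) (is_deriveX 2 (is_derive_id x (1 : R))).
  have -> : (- 2^-1) \*: (id ^+ 2 : R -> R) = (fun y : R => - y ^+ 2 / 2).
    by apply/funext => y; rewrite expr2 !fctE -[LHS]/(- 2^-1 * (y * y)) expr2; field.
  by move=> h; apply: is_derive_eq h _; rewrite -[LHS]/(- 2^-1 * (2 * x ^+ 1 * 1)) expr1; field.
have := @is_derive1_comp _ expR _ x _ _ (is_derive_expR _) d1.
move=> /(is_deriveZ (Num.sqrt (pi *+ 2))^-1) h.
by apply: is_derive_eq h _; rewrite /GRing.scale/=; ring.
Qed.

(** The integrand times the density is the derivative of [F * pdf], which vanishes at infinity
    because [F] grows at most linearly. *)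
Lemma stein (F f : R -> R) (c : R) :
  (forall x, is_derive x (1 : R) F (f x)) -> continuous f ->
  (forall x, `|F x| <= c * (1 + `|x|)) -> (forall x, `|f x| <= c) ->
  \int[gauss]_x (f x - x * F x) = 0.
Proof.
move=> dF cf Fc fc.
have c0 : 0 <= c := le_trans (normr_ge0 _) (fc 0).
have cF : continuous F.
  by move=> x; apply: differentiable_continuous; apply/derivable1_diffP; case: (dF x).
have cg : continuous (fun x => f x - x * F x).
  by move=> x; apply: cvgB; [exact: cf|apply: cvgM; [exact: cvg_id|exact: cF]].
have ig : gauss.-integrable setT (EFin \o (fun x => f x - x * F x)).
  apply: (@integrable_normal_le4 _ _ (3 * c)); first exact: continuous_measurable_fun.
  move=> x; rewrite (le_trans (ler_normB _ _))// normrM.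
  have x4 : `|x| + `|x| ^+ 2 <= 2 * (1 + x ^+ 4).
    rewrite -[x ^+ 4](_ : `|x| ^+ 4 = _); last by rewrite -normrX ger0_norm// exprn_even_ge0.
    have := normr_ge0 x; move: `|x| => y y0.
    by have := sqr_ge0 (y - 1); have := sqr_ge0 (y ^+ 2 - 1);nra.
  have : `|x| * `|F x| <= `|x| * (c * (1 + `|x|)) by apply: ler_wpM2l.
  have := fc x; have : 0 <= x ^+ 4 by exact: exprn_even_ge0.
  by nra.
have key : (4 * c / (n%:R + 1)) @[n --> \oo] --> (0 : R).
  rewrite -[X in _ --> X](mulr0 (4 * c)); apply: cvgM; first exact: cvg_cst.
  by under eq_fun do rewrite natr1; exact: cvg_harmonic.
(* With y = |x|, the density is at most 1 / (1 + y^2 / 2), and (1 + y)^2 <= 4 (1 + y^2 / 2). *)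
have bnd (x : R) n : `|x| = n%:R -> `|F x * pdf x| <= 4 * c / (n%:R + 1).
  move=> xn; rewrite normrM (ger0_norm (normal_pdf_ge0 _ _ _)).
  have n0 : 0 <= n%:R :> R by [].
  have hp : pdf x <= (1 + x ^+ 2 / 2)^-1.
    rewrite normal_pdf01 mulNr expRN -[leRHS]mul1r ler_pM ?invr_ge0 ?sqrtr_ge0 ?expR_ge0//.
      exact: normal_coef_le1.
    have : 0 <= x ^+ 2 by exact: sqr_ge0.
    by move=> x20; rewrite lef_pV2 ?posrE ?expR_gt0 ?expR_ge1Dx//; lra.
  apply: (@le_trans _ _ (c * (1 + `|x|) * (1 + x ^+ 2 / 2)^-1)).
    by apply: ler_pM => //; exact: normal_pdf_ge0.
  rewrite -[x ^+ 2](_ : `|x| ^+ 2 = _); last by rewrite -normrX ger0_norm// sqr_ge0.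
  rewrite xn; move: (n%:R) n0 => y y0.
  rewrite ler_pdivlMr; last by lra.
  rewrite mulrAC ler_pdivrMr; last by nra.
  by have := sqr_ge0 (y - 1); nra.
rewrite Rintegral_normal//.
apply: (@integral_derive_vanishing _ (fun x => F x * pdf x)).
- move=> x; have := @is_deriveM _ _ F pdf x 1 _ _ (dF x) (is_derive_normal_pdf x).
  by move=> h; apply: is_derive_eq h _; rewrite /GRing.scale/=; ring.
- by move=> x; apply: cvgM; [exact: cg|apply: continuous_normal_pdf; exact: oner_neq0].
- apply/integrable_normal => //; exact: continuous_measurable_fun.
- apply: norm_cvg0; apply: (@squeeze_cvgr _ _ _ _ (cst 0) (fun n => 4 * c / (n%:R + 1))) => //.
    by apply: nearW => n; rewrite normr_ge0 bnd//= normr_nat.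
  exact: cvg_cst.
- apply: norm_cvg0; apply: (@squeeze_cvgr _ _ _ _ (cst 0) (fun n => 4 * c / (n%:R + 1))) => //.
    by apply: nearW => n; rewrite normr_ge0 bnd//= normrN normr_nat.
  exact: cvg_cst.
Unshelve. all: by end_near. Qed.

End stein.

Section charfun.
Context (R : realType).
Notation mu := (@lebesgue_measure R).
Notation gauss := (@normal_prob R 0 1).

Lemma continuous_affine_comp (h : R -> R) (a b : R) :
  continuous h -> continuous (fun x => h (a + b * x)).
Proof.
move=> ch x; apply: (@cvg_comp _ _ _ (fun x => a + b * x) h).
  by apply: cvgD; [exact: cvg_cst|apply: cvgM; [exact: cvg_cst|exact: cvg_id]].
exact: ch.
Qed.

Lemma is_derive_affine (a b x : R) : is_derive x (1 : R) (fun y => a + b * y) b.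
Proof.
have := is_deriveD (is_derive_cst a x (1 : R)) (is_deriveZ b (is_derive_id x (1 : R))).
by move=> h; apply: is_derive_eq h _; rewrite -[LHS]/(0 + b * 1); ring.
Qed.

Lemma is_derive_affine_comp (h h' : R -> R) (a b x : R) :
  (forall y, is_derive y (1 : R) h (h' y)) ->
  is_derive x (1 : R) (fun y => h (a + b * y)) (h' (a + b * x) * b).
Proof.
by move=> dh; exact: (@is_derive1_comp _ h _ x _ _ (dh _) (is_derive_affine a b x)).
Qed.

Lemma le_poly4_abs (x : R) : `|x| <= 1 + x ^+ 4.
Proof.
rewrite -[x ^+ 4](_ : `|x| ^+ 4 = _); last by rewrite -normrX ger0_norm// exprn_even_ge0.
have := normr_ge0 x; move: `|x| => y y0.
by have := sqr_ge0 (y - 1); have := sqr_ge0 (y ^+ 2 - 1); nra.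
Qed.

Lemma le_poly4_sqr (x : R) : x ^+ 2 <= 1 + x ^+ 4.
Proof. by have := sqr_ge0 (x ^+ 2 - 1); have := sqr_ge0 x; nra. Qed.

Lemma integrable_normal_sqr : gauss.-integrable setT (EFin \o (fun x => x ^+ 2)).
Proof.
apply: (@integrable_normal_le4 _ _ 1); first exact: measurable_funX.
by move=> x; rewrite mul1r ger0_norm ?sqr_ge0// le_poly4_sqr.
Qed.

(** Stein's identity for the identity function. *)
Lemma normal_sqr : \int[gauss]_x (x ^+ 2) = 1.
Proof.
have := @stein R id (cst 1) 1; rewrite /=.
have -> : (fun x : R => 1 - x * x) = (fun x : R => 1 - x ^+ 2).
  by apply/funext => x; rewrite expr2.
rewrite RintegralB//; [|exact: (integrable_cstR gauss 1)|exact: integrable_normal_sqr].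
rewrite (Rexpectation_cst gauss) => h; apply/esym/eqP; rewrite -subr_eq0; apply/eqP.
apply: h => //.
- by move=> x; exact: cvg_cst.
- by move=> x; rewrite mul1r lerDr.
- by move=> x; rewrite normr1.
Qed.

Lemma normal_integrable_trig (h : R -> R) (a b : R) : continuous h ->
  (forall x, `|h x| <= 1) -> gauss.-integrable setT (EFin \o (fun x => h (a + b * x))).
Proof.
move=> ch h1; apply: (@bounded_integrable _ _ _ gauss _ 1) => //.
by apply: continuous_measurable_fun; exact: continuous_affine_comp.
Qed.

Lemma is_derive_expR_sqr (k x : R) :
  is_derive x (1 : R) (fun y => expR (k * y ^+ 2)) (2 * k * x * expR (k * x ^+ 2)).
Proof.
have := is_deriveZ k (is_deriveX 2 (is_derive_id x (1 : R))).
have -> : k \*: (id ^+ 2 : R -> R) = (fun y : R => k * y ^+ 2).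
  by apply/funext => y; rewrite expr2 !fctE -[LHS]/(k * (y * y)) expr2.
move=> h; have := @is_derive1_comp _ expR _ x _ _ (is_derive_expR _) h.
move=> {}h; apply: is_derive_eq h _.
by rewrite -[LHS]/(expR (k * x ^+ 2) * (k * (2 * x ^+ 1 * 1))) expr1; ring.
Qed.

(** As a function of [b] the integral satisfies F' = - b F: differentiate under the integral and
    apply Stein's identity to sin (a + b x). Hence F (b) exp (b^2 / 2) is constant. The free phase
    [a] yields the sine version by a shift of pi / 2, and lets Gaussian vectors be built coordinate
    by coordinate. *)
Lemma normal_cos (a b : R) :
  \int[gauss]_x cos (a + b * x) = cos a * expR (- b ^+ 2 / 2).
Proof.
pose F b := \int[gauss]_x cos (a + b * x).
have dF c : is_derive c (1 : R) F (- (c * F c)).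
  have := @is_derive_Rintegral _ _ _ gauss (fun b x => cos (a + b * x))
    (fun b x => - (x * sin (a + b * x))) (fun x => `|x|) c.
  rewrite (_ : \int[gauss]_x - (x * sin (a + c * x)) = - (c * F c)).
    apply.
    - move=> x y; rewrite (_ : (fun x0 => _) = (fun x0 => cos (a + y * x0))); last first.
        by apply/funext => z; rewrite (mulrC y).
      have := @is_derive_affine_comp cos (fun x => - sin x) a y x (@is_derive_cos R).
      by move=> h; apply: is_derive_eq h _; rewrite (mulrC y); ring.
    - move=> x; apply: normal_integrable_trig; first exact: continuous_cos.
      exact: cos_max.
    - by move=> x y; rewrite normrN normrM ler_piMr// sin_max.
    - apply: (@integrable_normal_le4 _ _ 1); first exact: normr_measurable.
      by move=> x; rewrite normr_id mul1r le_poly4_abs.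
  have := @stein R (fun x => sin (a + c * x)) (fun x => c * cos (a + c * x)) (1 + `|c|).
  have cint : gauss.-integrable setT (EFin \o (fun x => c * cos (a + c * x))).
    apply: integrableRZ; apply: normal_integrable_trig; first exact: continuous_cos.
    exact: cos_max.
  rewrite (@RintegralD _ _ _ gauss setT (fun x => c * cos (a + c * x))
    (fun x => - (x * sin (a + c * x))))//; last first.
    apply: (@integrable_normal_le4 _ _ 1).
      apply: measurableT_comp => //; apply: measurable_funM => //.
      by apply: continuous_measurable_fun; apply: continuous_affine_comp; exact: continuous_sin.
    move=> x; rewrite mul1r normrN normrM (le_trans _ (le_poly4_abs x))//.
    by rewrite ler_piMr// sin_max.
  rewrite RintegralZl//; last first.
    apply: normal_integrable_trig; [exact: continuous_cos|exact: cos_max].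
  rewrite -/(F c) => h; apply/eqP; rewrite -addr_eq0 addrC; apply/eqP; apply: h.
  - move=> x; have := @is_derive_affine_comp sin cos a c x (@is_derive_sin R).
    by move=> h1; rewrite mulrC; exact: h1.
  - move=> x; apply: cvgM; first exact: cvg_cst.
    by apply: continuous_affine_comp; exact: continuous_cos.
  - move=> x; apply: (le_trans (sin_max _)).
    by have := normr_ge0 c; have := normr_ge0 x; nra.
  - move=> x; rewrite normrM (@le_trans _ _ `|c|)//; last by rewrite lerDr.
    by rewrite ler_piMr// cos_max.
have cst : F b * expR (2^-1 * b ^+ 2) = F 0 * expR (2^-1 * 0 ^+ 2).
  apply: (@is_derive_0_is_cst _ (fun b => F b * expR (2^-1 * b ^+ 2))) => x.
  have := @is_deriveM _ _ F _ x 1 _ _ (dF x) (is_derive_expR_sqr 2^-1 x).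
  by move=> h; apply: is_derive_eq h _; rewrite /GRing.scale/=; field.
have F0 : F 0 = cos a.
  rewrite /F; under eq_Rintegral do rewrite mul0r addr0.
  exact: (Rexpectation_cst gauss).
move: cst; rewrite expr0n /= mulr0 expR0 mulr1 F0 => <-.
by rewrite mulNr expRN (mulrC 2^-1) mulfK// gt_eqF ?expR_gt0.
Qed.

End charfun.

(** The inverse is x times the power -1 of x^2, whose base is nonnegative; at 0 both sides take the
    default value 0. *)
Lemma measurable_invr (R : realType) : measurable_fun setT (@GRing.inv R).
Proof.
rewrite (_ : @GRing.inv R = (fun x => x * powR (x ^+ 2) (- 1))).
  apply: measurable_funM => //.
  exact: (measurableT_comp (measurable_powR (-1)) (exprn_measurable 2)).
apply/funext => x; have [->|x0] := eqVneq x 0; first by rewrite invr0 mul0r.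
by rewrite powR_inv1 ?sqr_ge0// expr2 invfM mulrA divff// mul1r.
Qed.

Lemma measurable_funV d (T : measurableType d) (R : realType) (f : T -> R) :
  measurable_fun setT f -> measurable_fun setT (fun x => (f x)^-1).
Proof. exact: measurableT_comp (@measurable_invr R). Qed.

Lemma measurable_funcos d (T : measurableType d) (R : realType) (f : T -> R) :
  measurable_fun setT f -> measurable_fun setT (fun x => cos (f x)).
Proof.
by apply: measurableT_comp; apply: continuous_measurable_fun; exact: continuous_cos.
Qed.

Lemma measurable_funsin d (T : measurableType d) (R : realType) (f : T -> R) :
  measurable_fun setT f -> measurable_fun setT (fun x => sin (f x)).
Proof.
by apply: measurableT_comp; apply: continuous_measurable_fun; exact: continuous_sin.
Qed.

Lemma Rintegral_indic d (T : measurableType d) (R : realType)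
    (mu : {measure set T -> \bar R}) (D : set T) : measurable D ->
  \int[mu]_x \1_D x = fine (mu D).
Proof. by move=> mD; rewrite /Rintegral integral_indic// setIT. Qed.

Lemma sin_le_abs (R : realType) (x : R) : `|sin x| <= `|x|.
Proof.
wlog x0 : x / 0 <= x.
  move=> h; have [/h//|x0] := leP 0 x.
  by have := h (- x); rewrite sinN !normrN oppr_ge0 => /(_ (ltW x0)).
move: x0; rewrite le_eqVlt => /predU1P[<-|x0]; first by rewrite sin0 normr0.
have [c _] := @MVT R sin cos 0 x x0 (fun y _ => @is_derive_sin R y)
  (continuous_subspaceT (@continuous_sin R)).
rewrite sin0 !subr0 => ->; rewrite normrM ler_piMl// cos_max//.
Qed.

(** * Fourier inversion of the normal distribution function *)

Section inversion.
Context (R : realType).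
Notation mu := (@lebesgue_measure R).
Notation gauss := (@normal_prob R 0 1).
Notation pdf := (@normal_pdf R 0 1).

Let k0 : R := (Num.sqrt (pi *+ 2))^-1.

(** At x = 0 the value is 0, by the convention on inverses, instead of the limit u; the point is
    null for the normal law. *)
Definition dirichlet (u x : R) : R := sin (u * x) / x.

Lemma measurable_dirichlet (u : R) : measurable_fun setT (dirichlet u).
Proof.
apply: measurable_funM; first by apply: measurable_funsin; exact: measurable_funM.
exact: measurable_invr.
Qed.

Lemma dirichlet_le (u x : R) : `|dirichlet u x| <= `|u|.
Proof.
rewrite /dirichlet; have [->|x0] := eqVneq x 0; first by rewrite invr0 mulr0 normr0.
rewrite normrM normfV ler_pdivrMr ?normr_gt0// -normrM; exact: sin_le_abs.
Qed.

Lemma integrable_dirichlet u : gauss.-integrable setT (EFin \o dirichlet u).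
Proof.
apply: (@bounded_integrable _ _ _ gauss _ `|u|); first exact: measurable_dirichlet.
exact: dirichlet_le.
Qed.

Lemma normal_set1 (x : R) : gauss [set x] = 0%E.
Proof.
apply/eqP; rewrite eq_le measure_ge0 andbT -set_itv1.
have := @normal_itv_le R x x 0 (lexx x) (fun z _ => sqr_ge0 z).
by rewrite subrr mul0r.
Qed.

(** Differentiating under the integral turns sin (u x) / x into cos (u x), whose Gaussian mean is
    known. The factor [(x != 0)%:R] in [f'] reflects that [dirichlet u 0] is constantly 0, with
    derivative 0 and not cos 0. *)
Lemma is_derive_normal_dirichlet (u : R) :
  is_derive u (1 : R) (fun u => \int[gauss]_x dirichlet u x) (expR (- u ^+ 2 / 2)).
Proof.
pose f' (u x : R) := (x != 0)%:R * cos (u * x).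
have := @is_derive_Rintegral _ _ _ gauss dirichlet f' (cst 1) u.
suff -> : \int[gauss]_x f' u x = expR (- u ^+ 2 / 2).
  apply.
  - move=> v x; rewrite /dirichlet /f'; have [->|x0] /= := eqVneq x 0.
      rewrite mul0r (_ : (fun _ => _) = cst 0); first exact: is_derive_cst.
      by apply/funext => y; rewrite mulr0 sin0 mul0r.
    have h := @is_derive_affine_comp R sin cos 0 x v (@is_derive_sin R).
    have := is_deriveZ x^-1 h.
    rewrite (_ : _ \*: _ = (fun u => sin (u * x) / x)); last first.
      by apply/funext => y; rewrite -[LHS]/(x^-1 * sin (0 + x * y)) add0r mulrC (mulrC x).
    move=> {}h; apply: is_derive_eq h _.
    rewrite -[LHS]/(x^-1 * (cos (0 + x * v) * x)) add0r mul1r.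
    by rewrite mulrC mulfK// mulrC.
  - by move=> v; exact: integrable_dirichlet.
  - move=> v x; rewrite /f' /=; case: (x != 0); first by rewrite mul1r cos_max.
    by rewrite mul0r normr0.
  - exact: (integrable_cstR gauss 1).
have -> : expR (- u ^+ 2 / 2) = \int[gauss]_x cos (0 + u * x).
  by rewrite normal_cos cos0 mul1r.
congr fine; apply: ae_eq_integral => //.
- apply/measurable_EFinP; apply: measurable_funM.
    rewrite (_ : (fun x => _) = \1_(~` [set (0 : R)])).
      exact: measurable_indic (measurableC (measurable_set1 0)).
    apply/funext => x; rewrite indicE; congr (nat_of_bool _)%:R.
    have [->|/eqP x0] := eqVneq x 0; first by rewrite memNset//=; apply.
    by rewrite mem_set.
  by apply: measurable_funcos; exact: measurable_funM.
- apply/measurable_EFinP; apply: measurable_funcos; apply: measurable_funD => //.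
- exists [set 0]; split; [exact: measurable_set1|exact: normal_set1|].
  move=> x /=; apply: contra_notP => /eqP x0 _; rewrite /f' x0.
  by rewrite mul1r add0r.
Qed.

(** This is the normal distribution function at u minus 1/2: an odd function whose derivative is the
    normal density. *)
Definition gauss_dirichlet (u : R) : R := k0 * \int[gauss]_x dirichlet u x.

Lemma is_derive_gauss_dirichlet (u : R) : is_derive u (1 : R) gauss_dirichlet (pdf u).
Proof.
have h := is_deriveZ k0 (is_derive_normal_dirichlet u); apply: is_derive_eq h _; by rewrite normal_pdf01 -[LHS]/(k0 * expR (- u ^+ 2 / 2)).
Qed.

Lemma normal_itvE (x y : R) : x <= y ->
  gauss `[x, y] = (gauss_dirichlet y - gauss_dirichlet x)%:E.
Proof.
move=> xy; rewrite /normal_prob.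
rewrite (derivable_everywhere_FTC2 xy is_derive_gauss_dirichlet)//.
by apply: continuous_normal_pdf; exact: oner_neq0.
Qed.

Lemma gauss_dirichletN (u : R) : gauss_dirichlet (- u) = - gauss_dirichlet u.
Proof.
rewrite /gauss_dirichlet -mulrN; congr (_ * _).
rewrite -mulN1r -RintegralZl//; last exact: integrable_dirichlet.
by apply: eq_Rintegral => x _; rewrite /dirichlet mulNr sinN mulN1r mulNr.
Qed.

Lemma gauss_dirichlet_homo : {homo gauss_dirichlet : x y / x <= y}.
Proof.
by move=> x y xy; rewrite -subr_ge0 -lee_fin -normal_itvE.
Qed.

(** By oddness, twice the value at u >= 0 is the normal mass of [-u, u]. *)
Lemma gauss_dirichlet_le_half (u : R) : `|gauss_dirichlet u| <= 1 / 2.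
Proof.
wlog u0 : u / 0 <= u.
  move=> h; have [/h//|x0] := leP 0 u.
  by have := h (- u); rewrite gauss_dirichletN normrN oppr_ge0 => /(_ (ltW x0)).
have Nuu : - u <= u by lra.
have := normal_itvE Nuu; rewrite gauss_dirichletN => E.
have g0 : gauss_dirichlet (- u) <= gauss_dirichlet u by exact: gauss_dirichlet_homo.
rewrite gauss_dirichletN in g0.
pose I : set R := `[- u, u]%classic.
have : (gauss I <= 1)%E by apply: probability_le1; exact: measurable_itv.
by rewrite E lee_fin => h; rewrite ger0_norm; lra.
Qed.

(** Chebyshev's inequality: the mass outside [-u, u] is at most u^-2, and half of it lies on each
    side. *)
Lemma gauss_dirichlet_tail (u : R) : 0 < u ->
  1 / 2 - (2 * u ^+ 2)^-1 <= gauss_dirichlet u.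
Proof.
move=> u0; have Nuu : - u <= u by lra.
have := normal_itvE Nuu; rewrite gauss_dirichletN => E.
have mI : measurable (`[- u, u]%classic : set R) by exact: measurable_itv.
have iI : gauss.-integrable setT (EFin \o (\1_(`[- u, u]%classic) : R -> R)).
  exact: integrable_indic.
have : \int[gauss]_x (1 - \1_(`[- u, u]%classic) x) <= \int[gauss]_x (u ^- 2 * x ^+ 2).
  apply: le_Rintegral => //.
  - by apply: integrableRB => //; exact: (integrable_cstR gauss 1).
  - apply: integrableRZ; exact: integrable_normal_sqr.
  - move=> x _; rewrite indicE; case: (boolP (x \in _)) => [_|].
      by rewrite subrr mulr_ge0 ?invr_ge0 ?sqr_ge0.
    rewrite notin_setE /= in_itv/= => /negP; rewrite -ler_norml -ltNge => ux.
    rewrite subr0 mulrC ler_pdivlMr ?exprn_gt0// mul1r -[leRHS]ger0_norm ?sqr_ge0//.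
    by rewrite normrX lerXn2r// ?nnegrE// ltW.
rewrite RintegralB//; last exact: (integrable_cstR gauss 1).
rewrite RintegralZl//; last exact: integrable_normal_sqr.
rewrite normal_sqr (Rexpectation_cst gauss) Rintegral_indic//= E /= mulr1 invfM.
lra.
Qed.

(** [smooth_step u] is the normal distribution function, written through its
    Fourier inversion formula. *)
Definition smooth_step (u : R) : R := 1 / 2 + gauss_dirichlet u.

Lemma smooth_step_ge0 u : 0 <= smooth_step u.
Proof. by have := gauss_dirichlet_le_half u; rewrite ler_norml /smooth_step; lra. Qed.

Lemma smooth_step_le1 u : smooth_step u <= 1.
Proof. by have := gauss_dirichlet_le_half u; rewrite ler_norml /smooth_step; lra. Qed.

(** For y <= x the shift by s v makes the argument at least v, where the tail bound applies;
    otherwise the indicator is 0. *)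
Lemma smooth_step_upper (v s x y : R) : 0 < v -> 0 < s ->
  (y <= x)%R%:R <= smooth_step ((x + s * v - y) / s) + (2 * v ^+ 2)^-1.
Proof.
move=> v0 s0; have t0 : 0 <= (2 * v ^+ 2)^-1 by rewrite invr_ge0 mulr_ge0 ?sqr_ge0.
case: (leP y x) => [yx|_] /=; last by rewrite addr_ge0 ?smooth_step_ge0.
have h : v <= (x + s * v - y) / s by rewrite ler_pdivlMr//; nra.
have := gauss_dirichlet_tail v0; have := gauss_dirichlet_homo h.
rewrite /smooth_step; lra.
Qed.

Lemma smooth_step_lower (v s x y : R) : 0 < v -> 0 < s ->
  smooth_step ((x - s * v - y) / s) <= (y <= x)%R%:R + (2 * v ^+ 2)^-1.
Proof.
move=> v0 s0; have t0 : 0 <= (2 * v ^+ 2)^-1 by rewrite invr_ge0 mulr_ge0 ?sqr_ge0.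
case: (leP y x) => [_|yx] /=; first by have := smooth_step_le1 ((x - s * v - y) / s); lra.
have h : (x - s * v - y) / s <= - v by rewrite ler_pdivrMr//; nra.
have := gauss_dirichlet_tail v0; have := gauss_dirichlet_homo h.
rewrite gauss_dirichletN /smooth_step; lra.
Qed.

End inversion.

Section Rfubini_dominated.
Context d1 d2 (T1 : measurableType d1) (T2 : measurableType d2) (R : realType).
Variables (P : probability T1 R) (Q : probability T2 R).
Variables (f : T1 * T2 -> R) (g : T1 -> R).
Hypothesis mf : measurable_fun setT f.
Hypothesis fg : forall z, `|f z| <= g z.1.
Hypothesis intg : P.-integrable setT (EFin \o g).

(** The inversion kernel is bounded only by |u|, which in applications is an unbounded but
    integrable function of the first variable. As the second measure has mass 1, such a bound
    dominates on the product. *)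
Lemma dominated_fubini_hyp :
  [/\ (P \x Q)%E.-integrable setT (EFin \o f),
   forall x, Q.-integrable setT (EFin \o (fun y => f (x, y))) &
   forall y, P.-integrable setT (EFin \o (fun x => f (x, y)))].
Proof.
split.
- apply/integrable12ltyP; first exact/measurable_EFinP.
  case/integrableP: intg => mg; apply: le_lt_trans.
  apply: ge0_le_integral_nomeas => x _; first exact: integral_ge0.
  have -> : ((`|(EFin \o g) x|) = \int[Q]_y `|(g x)%:E|)%E.
    by rewrite integral_cst//= (@probability_setT _ _ _ Q) mule1.
  apply: ge0_le_integral_nomeas => y _ //=.
  by rewrite lee_fin (le_trans (fg (x, y)))// ler_norm.
- move=> x; apply: (@bounded_integrable _ _ _ Q _ (g x)).
    exact: (measurableT_comp mf (pair1_measurable x)).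
  by move=> y; exact: fg (x, y).
- move=> y; apply: (@le_integrableR _ _ _ P _ g) => //.
  exact: (measurableT_comp mf (pair2_measurable y)).
Qed.

Lemma Rfubini_dominated :
  \int[P]_x \int[Q]_y f (x, y) = \int[Q]_y \int[P]_x f (x, y).
Proof. by have [? ? ?] := dominated_fubini_hyp; exact: Rfubini. Qed.

End Rfubini_dominated.

(** * Smoothing *)

Section Phi.
Context (R : realType).
Notation gauss := (@normal_prob R 0 1).
Implicit Types x y z : R.

Definition PhiR x : R := fine (Phi x).

Lemma PhiE x : Phi x = (PhiR x)%:E.
Proof. by rewrite fineK// fin_num_measure//; exact: measurable_itv. Qed.

Lemma indic_itvNyE x y : \1_(`]-oo, x]%classic : set R) y = (y <= x)%R%:R :> R.
Proof. by rewrite indicE mem_setE in_itv. Qed.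

Lemma measurable_le_indic d (T : measurableType d) (f : T -> R) x : measurable_fun setT f ->
  measurable_fun setT (fun w => (f w <= x)%R%:R : R).
Proof.
move=> mf; rewrite (_ : (fun w => _) = \1_(`]-oo, x]%classic) \o f).
  by apply: measurableT_comp mf; apply: measurable_indic; exact: measurable_itv.
by apply/funext => w /=; rewrite indic_itvNyE.
Qed.

Lemma integrable_le_indic x :
  gauss.-integrable setT (EFin \o (fun z => (z <= x)%R%:R : R)).
Proof.
apply: eq_integrable (@integrable_indic _ _ R gauss `]-oo, x]%classic _) => //.
by move=> z _ /=; rewrite indic_itvNyE.
Qed.

Lemma PhiR_int x : \int[gauss]_z (z <= x)%R%:R = PhiR x.
Proof.
rewrite /PhiR /Phi -Rintegral_indic//.
by apply: eq_Rintegral => z _; rewrite indic_itvNyE.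
Qed.

Lemma PhiR_homo : {homo PhiR : x y / x <= y}.
Proof.
move=> x y xy; rewrite -!PhiR_int; apply: le_Rintegral => //.
- exact: integrable_le_indic.
- exact: integrable_le_indic.
- move=> z _; rewrite ler_nat; case: (leP z x) => // zx.
  by rewrite (le_trans zx xy).
Qed.

Lemma PhiR_sub x y : x <= y -> PhiR y - PhiR x <= fine (gauss `[x, y]).
Proof.
move=> xy; rewrite -!PhiR_int -Rintegral_indic// -RintegralB//;
  [|exact: integrable_le_indic|exact: integrable_le_indic].
apply: le_Rintegral => //.
- by apply: integrableRB; exact: integrable_le_indic.
- by apply: integrable_indic; exact: measurable_itv.
- move=> z _; rewrite indicE mem_setE in_itv/=.
  by case: (leP z x) => zx; case: (leP z y) => zy; case: (leP x z) => xz //=; lra.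
Qed.

Lemma PhiR_lip x y : x <= y -> PhiR y - PhiR x <= y - x.
Proof.
move=> xy; apply: (le_trans (PhiR_sub xy)).
have := @normal_itv_le R x y 0 xy (fun z _ => sqr_ge0 z).
rewrite oppr0 mul0r expR0 mulr1 -[X in _ -> _ <= X]/(fine (y - x)%:E) => h.
by apply: fine_le => //; rewrite fin_num_measure//; exact: measurable_itv.
Qed.

Lemma abs_mul_exp_le (x : R) : `|x| * expR (- (x ^+ 2 / 4) / 2) <= 2.
Proof.
rewrite mulNr expRN ler_pdivrMr ?expR_gt0//.
apply: (@le_trans _ _ (2 * (1 + x ^+ 2 / 4 / 2))); last first.
  by rewrite ler_pM2l// expR_ge1Dx.
rewrite -[x ^+ 2](_ : `|x| ^+ 2 = _); last by rewrite -normrX ger0_norm// sqr_ge0.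
by have := sqr_ge0 (`|x| - 2); nra.
Qed.

Lemma PhiR_ge0 x : 0 <= PhiR x.
Proof. by rewrite /PhiR fine_ge0. Qed.

Lemma PhiR_le1 x : PhiR x <= 1.
Proof. by rewrite -lee_fin -PhiE; apply: probability_le1; exact: measurable_itv. Qed.

(** The interval between x and l x has length |l - 1| |x|, and its points have modulus at least |x|
    / 2, so the density there is at most exp (- x^2 / 8). This is the price of replacing theta by H,
    which rescales x by the radius. *)
Lemma PhiR_scale (l x : R) : 1 / 2 <= l -> `|PhiR (l * x) - PhiR x| <= 2 * `|l - 1|.
Proof.
move=> l2.
have key (a b : R) : a <= b -> (forall z, a <= z <= b -> x ^+ 2 / 4 <= z ^+ 2) ->
    b - a = `|l - 1| * `|x| -> `|PhiR b - PhiR a| <= 2 * `|l - 1|.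
  move=> ab h E.
  rewrite ger0_norm ?subr_ge0 ?PhiR_homo//; apply: (le_trans (PhiR_sub ab)).
  apply: (@le_trans _ _ ((b - a) * expR (- (x ^+ 2 / 4) / 2))).
    rewrite -[X in _ <= X]/(fine ((b - a) * _)%:E).
    apply: fine_le => //; first by rewrite fin_num_measure//; exact: measurable_itv.
    exact: normal_itv_le.
  by rewrite E -mulrA mulrC ler_wpM2r// abs_mul_exp_le.
have hp z : 0 <= x / 2 -> x / 2 <= z -> x ^+ 2 / 4 <= z ^+ 2 by move=> *; nra.
have hn z : x / 2 <= 0 -> z <= x / 2 -> x ^+ 2 / 4 <= z ^+ 2 by move=> *; nra.
have [x0|x0] := leP 0 x; have [l1|l1] := leP 1 l.
- apply: key; [nra| |by rewrite !ger0_norm ?subr_ge0//; ring].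
  by move=> z /andP[z1 _]; apply: hp; [lra|nra].
- rewrite distrC; apply: key; [nra| |].
    by move=> z /andP[z1 _]; apply: hp; [lra|nra].
  by rewrite ltr0_norm ?subr_lt0// ger0_norm//; ring.
- rewrite distrC; apply: key; [nra| |].
    by move=> z /andP[_ z1]; apply: hn; [lra|nra].
  by rewrite ger0_norm ?subr_ge0// ltr0_norm//; ring.
- apply: key; [nra| |].
    by move=> z /andP[_ z1]; apply: hn; [lra|nra].
  by rewrite ltr0_norm ?subr_lt0// ltr0_norm//; ring.
Qed.

Lemma continuous_smooth_step : continuous (@smooth_step R).
Proof.
move=> x; apply: cvgD; first exact: cvg_cst.
apply: differentiable_continuous; apply/derivable1_diffP.
by case: (is_derive_gauss_dirichlet x).
Qed.

Lemma integrable_smooth_step d (T : measurableType d) (P : probability T R) (f : T -> R) :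
  measurable_fun setT f -> P.-integrable setT (EFin \o (fun w => smooth_step (f w))).
Proof.
move=> mf; apply: (@bounded_integrable _ _ _ P _ 1).
  apply: measurableT_comp mf; apply: continuous_measurable_fun.
  exact: continuous_smooth_step.
by move=> x; rewrite ger0_norm ?smooth_step_ge0// smooth_step_le1.
Qed.

(** The distribution function at y of Z + s Z', with Z and Z' independent standard normal variables
    (s > 0). *)
Definition smooth_Phi (s y : R) : R := \int[gauss]_z smooth_step ((y - z) / s).

Let mdiv (s y : R) : measurable_fun setT (fun z : R => (y - z) / s).
Proof. by apply: measurable_funM => //; exact: measurable_funB. Qed.

Lemma smooth_Phi_le (v s x : R) : 0 < v -> 0 < s ->
  smooth_Phi s (x - s * v) <= PhiR x + (2 * v ^+ 2)^-1.
Proof.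
move=> v0 s0; rewrite -PhiR_int -[(2 * v ^+ 2)^-1](Rexpectation_cst gauss) -RintegralD//; last 2 first.
- exact: integrable_le_indic.
- exact: (integrable_cstR gauss).
apply: le_Rintegral => //.
- by apply: (@integrable_smooth_step _ _ gauss); exact: mdiv.
- by apply: integrableRD; [exact: integrable_le_indic|exact: (integrable_cstR gauss)].
- by move=> z _; exact: smooth_step_lower.
Qed.

Lemma smooth_Phi_ge (v s x : R) : 0 < v -> 0 < s ->
  PhiR x <= smooth_Phi s (x + s * v) + (2 * v ^+ 2)^-1.
Proof.
move=> v0 s0; rewrite -PhiR_int -[(2 * v ^+ 2)^-1](Rexpectation_cst gauss) -RintegralD//; last 2 first.
- by apply: (@integrable_smooth_step _ _ gauss); exact: mdiv.
- exact: (integrable_cstR gauss).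
apply: le_Rintegral => //.
- exact: integrable_le_indic.
- by apply: integrableRD; [by apply: (@integrable_smooth_step _ _ gauss); exact: mdiv|exact: (integrable_cstR gauss)].
- by move=> z _; exact: smooth_step_upper.
Qed.

End Phi.

Lemma normal_sin (R : realType) (a b : R) :
  \int[@normal_prob R 0 1]_x sin (a + b * x) = sin a * expR (- b ^+ 2 / 2).
Proof.
rewrite -cosBpihalf -normal_cos; apply: eq_Rintegral => x _.
by rewrite -cosBpihalf addrAC.
Qed.

(** * Smoothed distribution functions and the deviation of characteristic functions *)

Section smoothing.
Context (R : realType).
Notation gauss := (@normal_prob R 0 1).
Let k0 : R := (Num.sqrt (pi *+ 2))^-1.

Lemma measurable_dirichlet2 d (T : measurableType d) (f g : T -> R) :
  measurable_fun setT f -> measurable_fun setT g ->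
  measurable_fun setT (fun w => dirichlet (f w) (g w)).
Proof.
move=> mf mg; apply: measurable_funM; last exact: measurable_funV.
by apply: measurable_funsin; exact: measurable_funM.
Qed.

(** The kernel [dirichlet ((y - Z) / s) t] averaged over a standard normal Z. *)
Definition damped_dirichlet (s y t : R) : R := sin (y / s * t) * expR (- (t / s) ^+ 2 / 2) / t.

Lemma expR_Nsqr_le1 (x : R) : expR (- x ^+ 2 / 2) <= 1.
Proof. by rewrite -[leRHS]expR0 ler_expR mulNr oppr_le0 divr_ge0// sqr_ge0. Qed.

Lemma damped_dirichlet_le (s y t : R) : `|damped_dirichlet s y t| <= `|y / s|.
Proof.
rewrite /damped_dirichlet mulrAC normrM (ger0_norm (expR_ge0 _)).
apply: (le_trans _ (dirichlet_le (y / s) t)).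
by rewrite ler_piMr// expR_Nsqr_le1.
Qed.

Lemma measurable_damped (s y : R) : measurable_fun setT (damped_dirichlet s y).
Proof.
apply: measurable_funM; last exact: measurable_invr.
apply: measurable_funM; first by apply: measurable_funsin; exact: measurable_funM.
apply: measurableT_comp => //; apply: measurable_funM => //.
by apply: measurable_funN; apply: measurable_funX; exact: measurable_funM.
Qed.

Lemma integrable_damped (s y : R) : gauss.-integrable setT (EFin \o damped_dirichlet s y).
Proof.
apply: (@bounded_integrable _ _ _ gauss _ `|y / s|); first exact: measurable_damped.
exact: damped_dirichlet_le.
Qed.

Lemma smooth_PhiE (s y : R) :
  smooth_Phi s y = 1 / 2 + k0 * \int[gauss]_t damped_dirichlet s y t.
Proof.
have mz : measurable_fun setT (fun z : R => (y - z) / s).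
  by apply: measurable_funM => //; exact: measurable_funB.
pose f (z : R * R) := dirichlet ((y - z.1) / s) z.2.
have mf : measurable_fun setT f.
  by apply: measurable_dirichlet2 => //; apply: measurable_funM => //; exact: measurable_funB.
have fg z : `|f z| <= `|(y - z.1) / s| by exact: dirichlet_le.
have intg : gauss.-integrable setT (EFin \o (fun z => `|(y - z) / s|)).
  apply: (@integrable_normal_le4 _ _ ((1 + `|y|) / `|s|)); first exact: measurableT_comp.
  move=> z; rewrite normr_id normrM normfV mulrAC ler_wpM2r ?invr_ge0//.
  apply: (le_trans (ler_normB _ _)).
  have := le_poly4_abs z; have := normr_ge0 y; have : 0 <= z ^+ 4 by exact: exprn_even_ge0.
  by nra.
rewrite /smooth_Phi /smooth_step /gauss_dirichlet.
have [h1 h2 h3] := @dominated_fubini_hyp _ _ _ _ _ gauss gauss f _ mf fg intg.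
have ii : gauss.-integrable setT (EFin \o (fun z => \int[gauss]_t f (z, t))).
  exact: integrable_Rfubini1.
rewrite RintegralD//; [|exact: (integrable_cstR gauss)|exact: integrableRZ].
rewrite (Rexpectation_cst gauss) RintegralZl//; congr (_ + _ * _).
rewrite (@Rfubini _ _ _ _ _ gauss gauss f)//.
apply: eq_Rintegral => t _; rewrite /f /dirichlet /=.
under eq_Rintegral do rewrite mulrC.
rewrite RintegralZl//; last first.
  apply: (@bounded_integrable _ _ _ gauss _ 1); last by move=> z; exact: sin_max.
  by apply: measurable_funsin; exact: measurable_funM.
rewrite mulrC; congr (_ / _).
have := normal_sin (y / s * t) (- (t / s)); rewrite sqrrN => <-.
by apply: eq_Rintegral => z _; congr sin; ring.
Qed.

Context d (T : measurableType d) (P : probability T R) (chi S : T -> R).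
Hypothesis mchi : measurable_fun setT chi.
Hypothesis chi01 : forall w, 0 <= chi w <= 1.
Hypothesis intS : P.-integrable setT (EFin \o S).

Let mS : measurable_fun setT S.
Proof. by apply/measurable_EFinP; exact: measurable_int intS. Qed.

(** Together with [sin_dev], the real and imaginary parts of E chi (exp (i t S) - exp (- t^2 / 2)).
    The weight also multiplies the normal term, so that both parts vanish at t = 0, where they are
    to be divided by t. *)
Definition cos_dev (t : R) : R :=
  \int[P]_w (chi w * (cos (t * S w) - expR (- t ^+ 2 / 2))).

Definition sin_dev (t : R) : R := \int[P]_w (chi w * sin (t * S w)).

Lemma chi_bounded_integrable (f : T -> R) (M : R) : measurable_fun setT f ->
  (forall w, `|f w| <= M) -> P.-integrable setT (EFin \o (fun w => chi w * f w)).
Proof.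
move=> mf fM; apply: (@bounded_integrable _ _ _ P _ M).
  exact: measurable_funM.
move=> w; rewrite normrM; have /andP[c0 c1] := chi01 w.
by rewrite ger0_norm// (le_trans _ (fM w))// ler_piMl.
Qed.

(** The indicator for S and the one for the normal law are both squeezed between smoothed steps
    shifted by s v. The two tail errors add up to v^-2, and the two shifts cost 2 s v by the
    Lipschitz bound for [PhiR]. *)
Lemma weighted_smoothing (s v x B : R) : 0 < s -> 0 < v ->
  (forall y, `|\int[P]_w (chi w * (smooth_step ((y - S w) / s) - smooth_Phi s y))| <= B) ->
  `|\int[P]_w (chi w * ((S w <= x)%R%:R - PhiR x))| <= B + v ^- 2 + 2 * s * v.
Proof.
move=> s0 v0 hB.
have t0 : 0 <= (2 * v ^+ 2)^-1 by rewrite invr_ge0 mulr_ge0 ?sqr_ge0.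
have tE : v ^- 2 = (2 * v ^+ 2)^-1 + (2 * v ^+ 2)^-1 by field; rewrite gt_eqF.
have sv : 0 < s * v by exact: mulr_gt0.
have iU y : P.-integrable setT
    (EFin \o (fun w => chi w * (smooth_step ((y - S w) / s) - smooth_Phi s y))).
  apply: (@chi_bounded_integrable _ (1 + `|smooth_Phi s y|)).
    apply: measurable_funB => //; apply: measurableT_comp.
      by apply: continuous_measurable_fun; exact: continuous_smooth_step.
    by apply: measurable_funM => //; exact: measurable_funB.
  move=> w; apply: (le_trans (ler_normB _ _)); rewrite lerD2r.
  by rewrite ger0_norm ?smooth_step_ge0// smooth_step_le1.
have iD : P.-integrable setT (EFin \o (fun w => chi w * ((S w <= x)%R%:R - PhiR x))).
  apply: (@chi_bounded_integrable _ 1).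
    by apply: measurable_funB => //; exact: measurable_le_indic.
  move=> w; have := PhiR_ge0 x; have := PhiR_le1 x.
  by case: (S w <= x)%R => /=; rewrite ler_norml; lra.
have ic (c : R) : P.-integrable setT (EFin \o (fun=> c)) by exact: integrable_cstR.
set b := _ + 2 * s * v.
have bE : b = B + ((2 * v ^+ 2)^-1 + (2 * v ^+ 2)^-1 + 2 * (s * v)) by rewrite /b tE; ring.
rewrite ler_norml; apply/andP; split.
- have := hB (x - s * v); rewrite ler_norml => /andP[h _].
  have : \int[P]_w (chi w * (smooth_step ((x - s * v - S w) / s) - smooth_Phi s (x - s * v))
      - ((2 * v ^+ 2)^-1 + (2 * v ^+ 2)^-1 + 2 * (s * v)))
      <= \int[P]_w (chi w * ((S w <= x)%R%:R - PhiR x)).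
    apply: le_Rintegral => //; first exact: integrableRB.
    move=> w _; have /andP[c0 c1] := chi01 w.
    have h1 := smooth_step_lower x (S w) v0 s0.
    have := @smooth_Phi_ge R v s (x - 2 * (s * v)) v0 s0.
    have -> : x - 2 * (s * v) + s * v = x - s * v by ring.
    have lx : x - 2 * (s * v) <= x by lra.
    by have := PhiR_lip lx; nra.
  rewrite RintegralB// Rexpectation_cst; lra.
- have := hB (x + s * v); rewrite ler_norml => /andP[_ h].
  have : \int[P]_w (chi w * ((S w <= x)%R%:R - PhiR x)) <=
      \int[P]_w (chi w * (smooth_step ((x + s * v - S w) / s) - smooth_Phi s (x + s * v))
      + ((2 * v ^+ 2)^-1 + (2 * v ^+ 2)^-1 + 2 * (s * v))).
    apply: le_Rintegral => //; first exact: integrableRD.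
    move=> w _; have /andP[c0 c1] := chi01 w.
    have h1 := smooth_step_upper x (S w) v0 s0.
    have := @smooth_Phi_le R v s (x + 2 * (s * v)) v0 s0.
    have -> : x + 2 * (s * v) - s * v = x + s * v by ring.
    have lx : x <= x + 2 * (s * v) by lra.
    by have := PhiR_lip lx; nra.
  rewrite RintegralD// Rexpectation_cst; lra.
Qed.

(** Both smoothed distribution functions are expanded by the inversion formula and the integrals
    exchanged. The constant 1/2 cancels, and the trigonometric factors containing y are bounded by
    1, so the bound is uniform in y. The frequency is written [t / s], which turns the damping into
    the Gaussian measure itself. The right side may be infinite, hence the statement in [\bar R]. *)
Lemma smoothed_deviation_le (s y : R) : 0 < s ->
  (`|\int[P]_w (chi w * (smooth_step ((y - S w) / s) - smooth_Phi s y))|%:E <=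
   \int[gauss]_t (`|t|^-1 * (`|cos_dev (t / s)| + `|sin_dev (t / s)|))%:E)%E.
Proof.
move=> s0.
pose f (z : T * R) := chi z.1 * (dirichlet ((y - S z.1) / s) z.2 - damped_dirichlet s y z.2).
pose g w := `|(y - S w) / s| + `|y / s|.
have mf : measurable_fun setT f.
  apply: measurable_funM; first exact: measurableT_comp.
  apply: measurable_funB; last exact: (measurableT_comp (measurable_damped s y)).
  apply: measurable_dirichlet2 => //; apply: measurable_funM => //.
  by apply: measurable_funB => //; exact: measurableT_comp.
have fg z : `|f z| <= g z.1.
  rewrite /f normrM; have /andP[c0 c1] := chi01 z.1; rewrite ger0_norm//.
  apply: (@le_trans _ _ (1 * g z.1)); last by rewrite mul1r.
  apply: ler_pM => //; apply: (le_trans (ler_normB _ _)).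
  by rewrite lerD ?dirichlet_le ?damped_dirichlet_le.
have intg : P.-integrable setT (EFin \o g).
  apply: integrableRD; last exact: integrable_cstR.
  apply: integrable_norm => //.
  rewrite (_ : (fun w => _) = (fun w => s^-1 * (y - S w))).
    by apply: integrableRZ; apply: integrableRB => //; exact: integrable_cstR.
  by apply/funext => w; rewrite mulrC.
have [h1 h2 h3] := @dominated_fubini_hyp _ _ _ _ _ P gauss f g mf fg intg.
have -> : \int[P]_w (chi w * (smooth_step ((y - S w) / s) - smooth_Phi s y)) =
    k0 * \int[P]_w \int[gauss]_t f (w, t).
  rewrite -RintegralZl//; last exact: integrable_Rfubini1.
  apply: eq_Rintegral => w _; rewrite /f /= RintegralZl//; last first.
    by apply: integrableRB; [exact: integrable_dirichlet|exact: integrable_damped].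
  rewrite RintegralB//; [|exact: integrable_dirichlet|exact: integrable_damped].
  by rewrite smooth_PhiE /smooth_step /gauss_dirichlet -/k0; ring.
rewrite (Rfubini h1 h2 h3) normrM.
have fE t : \int[P]_w f (w, t) = t^-1 * (sin (y * (t / s)) * cos_dev (t / s)
    - cos (y * (t / s)) * sin_dev (t / s)).
  have ic : P.-integrable setT (EFin \o (fun w => chi w *
      (cos (t / s * S w) - expR (- (t / s) ^+ 2 / 2)))).
    apply: (@chi_bounded_integrable _ 2).
      by apply: measurable_funB => //; apply: measurable_funcos; exact: measurable_funM.
    move=> w; apply: (le_trans (ler_normB _ _)); rewrite (_ : 2 = 1 + 1)//.
    by rewrite lerD ?cos_max// ger0_norm ?expR_ge0// expR_Nsqr_le1.
  have is_ : P.-integrable setT (EFin \o (fun w => chi w * sin (t / s * S w))).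
    apply: (@chi_bounded_integrable _ 1); last by move=> w; exact: sin_max.
    by apply: measurable_funsin; exact: measurable_funM.
  rewrite /cos_dev /sin_dev -!RintegralZl// -RintegralB//; last 2 first.
  - exact: integrableRZ.
  - exact: integrableRZ.
  rewrite -RintegralZl//; last by apply: integrableRB; exact: integrableRZ.
  apply: eq_Rintegral => w _; rewrite /f /dirichlet /damped_dirichlet /=.
  have -> : (y - S w) / s * t = y * (t / s) - t / s * S w by ring.
  have -> : y / s * t = y * (t / s) by ring.
  by rewrite sinB; ring.
have k1 : `|k0| <= 1.
  by rewrite ger0_norm ?invr_ge0 ?sqrtr_ge0// normal_coef_le1.
apply: (@le_trans _ _ (`|\int[gauss]_t \int[P]_w f (w, t)|)%:E).
  by rewrite lee_fin ler_piMl.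
have iG : gauss.-integrable setT (EFin \o (fun t => \int[P]_w f (w, t))).
  exact: integrable_Rfubini2 h1 h3.
rewrite EFin_normr_Rintegral//.
apply: (le_trans (le_abse_integral _ _ _)) => //; first exact: measurable_int iG.
apply: ge0_le_integral_nomeas => t _ /=; first by rewrite lee_fin.
rewrite lee_fin fE normrM normfV ler_wpM2l ?invr_ge0//.
apply: (le_trans (ler_normB _ _)).
by rewrite !normrM lerD// ler_piMl// ?sin_max ?cos_max.
Qed.

End smoothing.

Section product_integral.
Context d1 d2 (T1 : measurableType d1) (T2 : measurableType d2) (R : realType).
Variables (P : probability T1 R) (Q : probability T2 R) (u : T1 -> R) (v : T2 -> R).
Hypothesis intu : P.-integrable setT (EFin \o u).
Hypothesis intv : Q.-integrable setT (EFin \o v).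

Let mu : measurable_fun setT u.
Proof. by apply/measurable_EFinP; exact: measurable_int intu. Qed.
Let mv : measurable_fun setT v.
Proof. by apply/measurable_EFinP; exact: measurable_int intv. Qed.

Lemma integrable_prodM : (P \x Q)%E.-integrable setT (EFin \o (fun z => u z.1 * v z.2)).
Proof.
apply/integrable12ltyP.
  by apply/measurable_EFinP; apply: measurable_funM; exact: measurableT_comp.
have E x : (\int[Q]_y `|(EFin \o (fun z => (u z.1 * v z.2)%R)) (x, y)| =
    `|(u x)%:E| * \int[Q]_y `|(v y)%:E|)%E.
  rewrite -ge0_integralZl//; last exact/measurable_EFinP/measurableT_comp.
  by apply: eq_integral => y _ /=; rewrite normrM EFinM.
under eq_integral do rewrite E.
case/integrableP: intv => _ vfin; case/integrableP: intu => _ ufin.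
rewrite ge0_integralZr//; last 2 first.
- exact/measurable_EFinP/measurableT_comp.
- exact: integral_ge0.
by rewrite lte_mul_pinfty//; [exact: integral_ge0|rewrite ge0_fin_numE//; exact: integral_ge0].
Qed.

Lemma Rintegral_prodM :
  \int[(P \x Q)%E]_z (u z.1 * v z.2) = \int[P]_x u x * \int[Q]_y v y.
Proof.
rewrite -(@Rfubini1 _ _ _ _ _ P Q (fun z => u z.1 * v z.2)) /=.
- rewrite -RintegralZr//; apply: eq_Rintegral => x _.
  by rewrite RintegralZl.
- exact: integrable_prodM.
- by move=> x /=; exact: integrableRZ.
Qed.

End product_integral.

(** * The variance kernel *)

Section elementary.
Context (R : realType).
Implicit Types t a b c u v x y : R.

Lemma expR_sub1_le v : `|expR v - 1| <= `|v| * expR `|v|.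
Proof.
have [v0|v0] := leP 0 v.
  rewrite (ger0_norm v0) ger0_norm; last by rewrite subr_ge0 -[leLHS]expR0 ler_expR.
  have := expR_ge1Dx (- v); have := expR_gt0 v; have := expRxMexpNx_1 v.
  by move: (expR v) (expR (- v)) => e e' ? ? ?; nra.
rewrite ltr0_norm; last by rewrite subr_lt0 -[ltRHS]expR0 ltr_expR.
rewrite ltr0_norm// opprB.
have := expR_ge1Dx v; have : 1 <= expR (- v) by rewrite -[leLHS]expR0 ler_expR; lra.
by nra.
Qed.

Lemma expR_sub1_sub_le v : expR v - 1 - v <= v ^+ 2 * expR `|v|.
Proof.
have h : expR v - 1 - v <= v * (expR v - 1).
  have := expR_ge1Dx (- v); have := expR_gt0 v; have := expRxMexpNx_1 v.
  by move: (expR v) (expR (- v)) => e e' ? ? ?; nra.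
apply: (le_trans h); apply: (le_trans (ler_norm _)); rewrite normrM.
rewrite -[v ^+ 2](_ : `|v| ^+ 2 = _); last by rewrite -normrX ger0_norm// sqr_ge0.
by rewrite expr2 -mulrA ler_wpM2l// expR_sub1_le.
Qed.

Lemma expR_sub1_sub_le_exp v : expR v - 1 - v <= expR `|v|.
Proof.
have [v0|v0] := leP 0 v; first by rewrite ger0_norm//; lra.
have e1 : expR v <= 1 by rewrite -[leRHS]expR0 ler_expR ltW.
by rewrite ltr0_norm//; have := expR_ge1Dx (- v); lra.
Qed.

(** Put u = t^2 (a + b) / 2 and v = t^2 c, so |v| <= u. If |v| <= u / 2, a damping exp (- t^2 / 4)
    survives and absorbs t^4, with constant 64. If |v| > u / 2, then |c| > (a + b) / 4 >= 1/4, and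
    the left side, at most 1, is below 16 c^2. For small t the plain bound t^4 c^2 is better. *)
Lemma second_order_le t a b c : 1 / 2 <= a -> 1 / 2 <= b -> `|c| <= (a + b) / 2 ->
  expR (- t ^+ 2 * (a + b) / 2) * (expR (t ^+ 2 * c) - 1 - t ^+ 2 * c) <=
  64 * Num.min 1 (t ^+ 2) * c ^+ 2.
Proof.
move=> a2 b2 cab.
have t0 : 0 <= t ^+ 2 := sqr_ge0 t.
have c20 : 0 <= c ^+ 2 := sqr_ge0 c.
pose u := t ^+ 2 * (a + b) / 2; pose v := t ^+ 2 * c.
have -> : - t ^+ 2 * (a + b) / 2 = - u by rewrite /u; ring.
have ut : t ^+ 2 / 2 <= u by rewrite /u; nra.
have vE : `|v| = t ^+ 2 * `|c| by rewrite /v normrM ger0_norm.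
have vu : `|v| <= u by rewrite vE /u; nra.
have u0 : 0 <= expR (- u) := expR_ge0 _.
have b1 : expR (- u) * (expR v - 1 - v) <= v ^+ 2 * expR (`|v| - u).
  rewrite [in leRHS]addrC expRD mulrCA; apply: ler_wpM2l => //.
  exact: expR_sub1_sub_le.
have b2' : expR (- u) * (expR v - 1 - v) <= expR (`|v| - u).
  rewrite [in leRHS]addrC expRD; apply: ler_wpM2l => //.
  exact: expR_sub1_sub_le_exp.
have e1 : expR (`|v| - u) <= 1 by rewrite -[leRHS]expR0 ler_expR subr_le0.
have v2E : v ^+ 2 = t ^+ 4 * c ^+ 2 by rewrite /v; ring.
have t4 : 0 <= t ^+ 4 by exact: exprn_even_ge0.
have bt : expR (- u) * (expR v - 1 - v) <= t ^+ 4 * c ^+ 2.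
  by apply: (le_trans b1); rewrite -v2E ler_piMr ?sqr_ge0.
have b64 : expR (- u) * (expR v - 1 - v) <= 64 * c ^+ 2.
  have [h|h] := leP `|v| (u / 2).
    apply: (le_trans b1); rewrite v2E mulrAC ler_wpM2r//.
    apply: le_trans (expR_sqr4 t); apply: ler_wpM2l => //.
    by rewrite ler_expR; lra.
  apply: (le_trans b2'); apply: (le_trans e1).
  have c4 : 1 / 4 <= `|c|.
    rewrite leNgt; apply/negP => c4; move: h; rewrite vE /u => h.
    by nra.
  rewrite -[c ^+ 2](_ : `|c| ^+ 2 = _); last by rewrite -normrX ger0_norm.
  by nra.
rewrite -/v; have [h|h] := leP 1 (t ^+ 2); first by rewrite mulr1.
apply: (le_trans bt); apply: ler_wpM2r => //.
by rewrite (_ : t ^+ 4 = t ^+ 2 * t ^+ 2); [nra|ring].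
Qed.

Lemma expRN_lip x y : 0 <= x -> x <= y -> expR (- x) - expR (- y) <= (y - x) * expR (- x).
Proof.
move=> x0 xy; have -> : - y = - x + - (y - x) by ring.
rewrite expRD; have := expR_ge1Dx (- (y - x)); have := expR_gt0 (- x).
by move: (expR _) (expR _) => e e' ? ?; nra.
Qed.

(** Both exponents are at least t^2 / 4 because a >= 1/2, so the exponential is Lipschitz there with
    constant exp (- t^2 / 4). *)
Lemma bias_le t a : 1 / 2 <= a ->
  `|expR (- t ^+ 2 * a / 2) - expR (- t ^+ 2 / 2)| <= 2 * Num.min 1 (t ^+ 2) * `|a - 1|.
Proof.
move=> a2; have t0 : 0 <= t ^+ 2 := sqr_ge0 t.
have key x y : t ^+ 2 / 4 <= x -> x <= y ->
    `|expR (- x) - expR (- y)| <= (y - x) * expR (- (t ^+ 2 / 4)).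
  move=> tx xy; have x0 : 0 <= x by apply: le_trans tx; rewrite divr_ge0.
  rewrite ger0_norm; last by rewrite subr_ge0 ler_expR lerN2.
  apply: (le_trans (expRN_lip x0 xy)); apply: ler_wpM2l; first by rewrite subr_ge0.
  by rewrite ler_expR lerN2.
have h : `|expR (- t ^+ 2 * a / 2) - expR (- t ^+ 2 / 2)| <=
    t ^+ 2 / 2 * expR (- (t ^+ 2 / 4)) * `|a - 1|.
  have -> : - t ^+ 2 * a / 2 = - (t ^+ 2 * a / 2) by ring.
  have -> : - t ^+ 2 / 2 = - (t ^+ 2 / 2) by ring.
  have [a1|a1] := leP 1 a.
    rewrite distrC (ger0_norm (_ : 0 <= a - 1)) ?subr_ge0//.
    apply: le_trans (key _ _ _ _) _; [lra|nra|].
    by rewrite le_eqVlt; apply/orP; left; apply/eqP; ring.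
  rewrite (ltr0_norm (_ : a - 1 < 0)) ?subr_lt0//.
  apply: le_trans (key _ _ _ _) _; [nra|nra|].
  by rewrite le_eqVlt; apply/orP; left; apply/eqP; ring.
apply: (le_trans h); apply: ler_wpM2r => //.
have e1 : expR (- (t ^+ 2 / 4)) <= 1 by rewrite -[leRHS]expR0 ler_expR oppr_le0 divr_ge0.
have := expR_ge1Dx (t ^+ 2 / 4); have := expRxMexpNx_1 (t ^+ 2 / 4).
have := expR_gt0 (- (t ^+ 2 / 4)); move: (expR _) (expR _) e1 => e e' e1 ? ? ?.
by have [?|?] := leP 1 (t ^+ 2); nra.
Qed.

Lemma first_order_le t : t ^+ 2 * expR (- t ^+ 2 / 2) <= 2 * Num.min 1 (t ^+ 2).
Proof.
have t0 : 0 <= t ^+ 2 := sqr_ge0 t.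
rewrite mulNr.
have e1 : expR (- (t ^+ 2 / 2)) <= 1 by rewrite -[leRHS]expR0 ler_expR oppr_le0 divr_ge0.
have := expR_ge1Dx (t ^+ 2 / 2); have := expRxMexpNx_1 (t ^+ 2 / 2).
have := expR_gt0 (- (t ^+ 2 / 2)); move: (expR _) (expR _) e1 => e e' e1 ? ? ?.
by have [?|?] := leP 1 (t ^+ 2); nra.
Qed.

End elementary.

Lemma min1_ge0 (R : realType) (t : R) : 0 <= Num.min 1 (t ^+ 2).
Proof. by rewrite le_min ler01 sqr_ge0. Qed.

Section inner_product.
Context (R : realType) (n : nat).
Implicit Types x y z : n.-tuple R.

Definition tlin (a : R) x (b : R) y : n.-tuple R :=
  [tuple a * tnth x i + b * tnth y i | i < n].

Lemma innerC x y : inner x y = inner y x.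
Proof. by apply: eq_bigr => i _; rewrite mulrC. Qed.

Lemma inner_tlinl a x b y z : inner (tlin a x b y) z = a * inner x z + b * inner y z.
Proof.
rewrite /inner !mulr_sumr -big_split; apply: eq_bigr => i _ /=.
by rewrite tnth_mktuple; ring.
Qed.

Lemma inner_tlinr a x b y z : inner z (tlin a x b y) = a * inner z x + b * inner z y.
Proof. by rewrite innerC inner_tlinl !(innerC z). Qed.

Lemma inner_ge0 x : 0 <= inner x x.
Proof. by apply: sumr_ge0 => i _; rewrite -expr2 sqr_ge0. Qed.

Lemma inner_le x y : `|inner x y| <= (inner x x + inner y y) / 2.
Proof.
have := inner_ge0 (tlin 1 x 1 y); have := inner_ge0 (tlin 1 x (-1) y).
rewrite !inner_tlinl !inner_tlinr (innerC y x) => h1 h2.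
by rewrite ler_norml; apply/andP; split; lra.
Qed.

Lemma enorm_sqr x : enorm x ^+ 2 = inner x x.
Proof. by rewrite sqr_sqrtr// inner_ge0. Qed.

End inner_product.

Lemma measurable_inner d (T : measurableType d) (R : realType) n (f g : T -> n.-tuple R) :
  measurable_fun setT f -> measurable_fun setT g ->
  measurable_fun setT (fun w => inner (f w) (g w)).
Proof.
move=> mf mg; apply: measurable_sum => i; apply: measurable_funM.
  exact: (measurableT_comp (measurable_tnth i) mf).
exact: (measurableT_comp (measurable_tnth i) mg).
Qed.

Lemma Rintegral_sum d (T : measurableType d) (R : realType)
    (P : {measure set T -> \bar R}) (I : Type) (s : seq I) (f : I -> T -> R) :
  (forall i, P.-integrable setT (EFin \o f i)) ->
  P.-integrable setT (EFin \o (fun x => \sum_(i <- s) f i x)) /\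
  \int[P]_x (\sum_(i <- s) f i x) = \sum_(i <- s) \int[P]_x f i x.
Proof.
move=> If; elim: s => [|i s [IHi IH]].
  under [X in EFin \o X]eq_fun do rewrite big_nil.
  under eq_Rintegral do rewrite big_nil.
  split; last by rewrite big_nil Rintegral_cst// mul0r.
  exact: integrable0.
split.
  under [X in EFin \o X]eq_fun do rewrite big_cons.
  exact: integrableRD.
by under eq_Rintegral do rewrite big_cons; rewrite RintegralD// IH big_cons.
Qed.

(** * The kernel on two independent copies of X and its expectation *)

Section kernel.
Context (R : realType) (n : nat) (n0 : (0 < n)%N).
Context d (T : measurableType d) (P : probability T R) (X : T -> n.-tuple R).
Context d' (T' : measurableType d') (Q : probability T' R) (H : T' -> n.-tuple R).
Hypothesis mX : measurable_fun setT X.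
Hypothesis mH : measurable_fun setT H.
Hypothesis charH : forall z, \int[Q]_h cos (inner z (H h)) = expR (- (inner z z / n%:R) / 2).

Definition nsq (w : T) : R := inner (X w) (X w) / n%:R.
Definition chi (w : T) : R := (1 / 2 <= nsq w)%R%:R.
(** The independent copy of X is realized as the second coordinate of [T * T] under [P \x P]. *)
Definition ncorr (z : T * T) : R := inner (X z.1) (X z.2) / n%:R.
Let e (t : R) : R := expR (- t ^+ 2 / 2).
Let psi (t : R) (w : T) : R := expR (- t ^+ 2 * nsq w / 2).

Hypothesis intX2 : P.-integrable setT (EFin \o nsq).
Variable M : R.
Hypothesis intXz : forall z, P.-integrable setT (EFin \o (fun w => inner (X w) z ^+ 2)).
Hypothesis hM : forall z, \int[P]_w (inner (X w) z ^+ 2) <= M * inner z z.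

Let nR0 : 0 < n%:R :> R. Proof. by rewrite ltr0n. Qed.

Lemma nsq_ge0 w : 0 <= nsq w. Proof. by rewrite divr_ge0// inner_ge0. Qed.

Lemma measurable_nsq : measurable_fun setT nsq.
Proof. by apply: measurable_funM => //; exact: measurable_inner. Qed.

Lemma chi01 w : 0 <= chi w <= 1.
Proof. by rewrite /chi; case: (1 / 2 <= _) => /=; lra. Qed.

Lemma measurable_chi : measurable_fun setT chi.
Proof.
rewrite (_ : chi = \1_(`[(1 / 2 : R), +oo[%classic) \o nsq).
  by apply: measurableT_comp measurable_nsq; apply: measurable_indic; exact: measurable_itv.
by apply/funext => w; rewrite /chi /= indicE mem_setE in_itv/= andbT.
Qed.

Lemma measurable_ncorr : measurable_fun setT ncorr.
Proof.
apply: measurable_funM => //; apply: measurable_inner.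
  exact: measurableT_comp mX measurable_fst.
exact: measurableT_comp mX measurable_snd.
Qed.

Lemma ncorr_le z : `|ncorr z| <= (nsq z.1 + nsq z.2) / 2.
Proof.
rewrite /ncorr /nsq normrM (ger0_norm (_ : 0 <= n%:R^-1)) ?invr_ge0//.
rewrite -mulrDl mulrAC ler_wpM2r ?invr_ge0//; exact: inner_le.
Qed.

(** With the second copy frozen, the second-moment bound in the direction [X w'] gives at most (M /
    n) [nsq w'], which is integrable. *)
Lemma integrable_ncorr_sqr : (P \x P)%E.-integrable setT (EFin \o (fun z => ncorr z ^+ 2)).
Proof.
apply/integrable21ltyP.
  by apply/measurable_EFinP; apply: measurable_funX; exact: measurable_ncorr.
have h w' : (\int[P]_w `|(EFin \o (fun z => (ncorr z ^+ 2)%R)) (w, w')| <=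
    ((M / n%:R) * nsq w')%:E)%E.
  apply: (@le_trans _ _ (\int[P]_w ((n%:R ^- 2)%:E * (inner (X w) (X w') ^+ 2)%:E)))%E.
    apply: ge0_le_integral_nomeas => w _ //=.
    by rewrite -EFinM lee_fin ger0_norm ?sqr_ge0// /ncorr exprMn exprVn mulrC.
  rewrite integralZl//; last exact: intXz.
  have fin : (\int[P]_w (inner (X w) (X w') ^+ 2)%:E)%E \is a fin_num.
    by apply: integrable_fin_num => //; exact: intXz.
  rewrite -(fineK fin) -EFinM lee_fin /nsq.
  apply: (@le_trans _ _ (n%:R ^- 2 * (M * inner (X w') (X w')))).
    by rewrite ler_wpM2l ?invr_ge0 ?exprn_ge0//; exact: hM.
  by rewrite le_eqVlt; apply/orP; left; apply/eqP; field; rewrite gt_eqF.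
apply: (@le_lt_trans _ _ (\int[P]_w' `|((M / n%:R) * nsq w')%:E|))%E.
  apply: ge0_le_integral_nomeas => w' _; first exact: integral_ge0.
  by rewrite (le_trans (h w'))// lee_fin ler_norm.
by have /integrableP[] := integrableRZ (M / n%:R) intX2.
Qed.

Lemma Rintegral_ncorr_sqr : \int[(P \x P)%E]_z (ncorr z ^+ 2) <= M / n%:R * \int[P]_w nsq w.
Proof.
have sE w w' : ncorr (w, w') ^+ 2 = n%:R ^- 2 * inner (X w) (X w') ^+ 2.
  by rewrite /ncorr exprMn exprVn mulrC.
have sE' w w' : ncorr (w, w') ^+ 2 = n%:R ^- 2 * inner (X w') (X w) ^+ 2.
  by rewrite sE innerC.
have i1 w : P.-integrable setT (EFin \o (fun w' => ncorr (w, w') ^+ 2)).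
  rewrite (_ : (fun w' => _) = (fun w' => n%:R ^- 2 * inner (X w') (X w) ^+ 2)).
    exact: integrableRZ.
  by apply/funext => w'; rewrite sE'.
rewrite -(@Rfubini1 _ _ _ _ _ P P (fun z => ncorr z ^+ 2) integrable_ncorr_sqr i1).
rewrite -RintegralZl//; apply: le_Rintegral => //.
- exact: integrable_Rfubini1 integrable_ncorr_sqr i1.
- exact: integrableRZ.
- move=> w _; under eq_Rintegral do rewrite sE'.
  rewrite RintegralZl//; apply: (@le_trans _ _ (n%:R ^- 2 * (M * inner (X w) (X w)))).
    by rewrite ler_wpM2l ?invr_ge0 ?exprn_ge0//; exact: hM.
  by rewrite /nsq le_eqVlt; apply/orP; left; apply/eqP; field; rewrite gt_eqF.
Qed.

Lemma measurable_psi t : measurable_fun setT (psi t).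
Proof.
apply: measurableT_comp => //; apply: measurable_funM => //; apply: measurable_funM => //.
exact: measurable_nsq.
Qed.

Lemma psi_le1 t w : 0 <= psi t w <= 1.
Proof.
rewrite expR_ge0/= -[leRHS]expR0 ler_expR.
by have := nsq_ge0 w; have := sqr_ge0 t; nra.
Qed.

Lemma integrable_chipsi t (f : T -> R) : P.-integrable setT (EFin \o f) ->
  P.-integrable setT (EFin \o (fun w => chi w * psi t w * f w)).
Proof.
move=> If; apply: (@le_integrableR _ _ _ P _ (fun w => `|f w|)).
- apply: measurable_funM; first by apply: measurable_funM; [exact: measurable_chi|exact: measurable_psi].
  by apply/measurable_EFinP; exact: measurable_int If.
- move=> w; rewrite normrM ler_piMl// ger0_norm.
    by have := chi01 w; have := psi_le1 t w; nra.
  by have := chi01 w; have := psi_le1 t w; nra.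
- exact: integrable_norm.
Qed.

Lemma integrable_coord z : P.-integrable setT (EFin \o (fun w => inner (X w) z)).
Proof.
apply: (@le_integrableR _ _ _ P _ (fun w => 1 + inner (X w) z ^+ 2)).
- exact: measurable_inner.
- move=> w; rewrite -[_ ^+ 2](_ : `|inner (X w) z| ^+ 2 = _); last by rewrite -normrX ger0_norm// sqr_ge0.
  by have := sqr_ge0 (`|inner (X w) z| - 1); nra.
- by apply: integrableRD => //; exact: integrable_cstR.
Qed.

Definition tdelta (i : 'I_n) : n.-tuple R := [tuple (i == j)%:R | j < n].

Lemma inner_tdelta (x : n.-tuple R) i : inner x (tdelta i) = tnth x i.
Proof.
rewrite /inner (bigD1 i)//= tnth_mktuple eqxx mulr1 big1 ?addr0// => j ji.
by rewrite tnth_mktuple eq_sym (negbTE ji) mulr0.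
Qed.

(** Testing [wmean] against its own direction in the second-moment bound makes
    the first-order term of the kernel O(M/n). *)
Definition wmean t : n.-tuple R := [tuple \int[P]_w (chi w * psi t w * tnth (X w) i) | i < n].

Let wcoord t (i : 'I_n) (w : T) : R := chi w * psi t w * tnth (X w) i.

Let integrable_wcoord t i : P.-integrable setT (EFin \o wcoord t i).
Proof.
apply: integrable_chipsi; have := integrable_coord (tdelta i).
by rewrite (_ : (fun w => _) = (fun w => tnth (X w) i))//; apply/funext => w; rewrite inner_tdelta.
Qed.

Lemma inner_wmean t z : inner (wmean t) z = \int[P]_w (chi w * psi t w * inner (X w) z).
Proof.
have Ii (i : 'I_n) : P.-integrable setT (EFin \o (fun w => tnth z i * wcoord t i w)).
  exact: integrableRZ.
have [_ h] := Rintegral_sum (index_enum 'I_n) Ii.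
transitivity (\int[P]_w (\sum_i tnth z i * wcoord t i w)).
  rewrite h; apply: eq_bigr => i _; rewrite RintegralZl// mulrC.
  by rewrite tnth_mktuple.
apply: eq_Rintegral => w _; rewrite /inner mulr_sumr; apply: eq_bigr => i _.
by rewrite /wcoord; ring.
Qed.

Lemma psi_chi_le t w : chi w * psi t w <= expR (- t ^+ 2 / 4).
Proof.
rewrite /chi; have [h|h] := leP (1 / 2) (nsq w); last by rewrite mul0r expR_ge0.
by rewrite mul1r ler_expR; have := sqr_ge0 t; nra.
Qed.

(** With m the vector [wmean t] and k the weight [chi w * psi t w], |m|^2 = E k <X, m>. AM-GM with
    weight M bounds this by E <X, m>^2 / (2 M) + M E k^2 / 2; the first term is at most |m|^2 / 2
    and is absorbed on the left. *)
Lemma inner_wmean_le t : 0 < M -> inner (wmean t) (wmean t) <= M * expR (- t ^+ 2 / 2).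
Proof.
move=> M0; set m := wmean t; set q := inner m m.
have q0 : 0 <= q := inner_ge0 m.
have : q <= \int[P]_w (M^-1 / 2 * inner (X w) m ^+ 2 + M / 2 * expR (- t ^+ 2 / 2)).
  rewrite /q {1}/m inner_wmean; apply: le_Rintegral => //.
  - exact: integrable_chipsi (integrable_coord m).
  - by apply: integrableRD; [exact: integrableRZ|exact: integrable_cstR].
  - move=> w _; have -> : expR (- t ^+ 2 / 2) = expR (- t ^+ 2 / 4) ^+ 2.
      by rewrite [RHS]expr2 -expRD; congr expR; field.
    have k0 : 0 <= chi w * psi t w.
      by have := chi01 w; have := psi_le1 t w; nra.
    have := psi_chi_le t w; move: (chi w * psi t w) (expR _) (inner _ _) k0 => k ee x k0 ke.
    have h : 2 * (k * x) <= M^-1 * x ^+ 2 + M * k ^+ 2.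
      rewrite -subr_ge0.
      have -> : M^-1 * x ^+ 2 + M * k ^+ 2 - 2 * (k * x) = M^-1 * (x - M * k) ^+ 2.
        by field; rewrite gt_eqF.
      by rewrite mulr_ge0 ?invr_ge0 ?sqr_ge0// ltW.
    have : M * k ^+ 2 <= M * ee ^+ 2 by rewrite ler_pM2l//; nra.
    lra.
rewrite RintegralD//; [|exact: integrableRZ|exact: integrable_cstR].
rewrite (Rexpectation_cst P) RintegralZl// => h.
have : M^-1 / 2 * \int[P]_w (inner (X w) m ^+ 2) <= M^-1 / 2 * (M * q).
  by rewrite ler_wpM2l ?hM// divr_ge0// invr_ge0 ltW.
have -> : M^-1 / 2 * (M * q) = q / 2 by field; rewrite gt_eqF.
lra.
Qed.

Let integrable_wcoord2 t i :
  (P \x P)%E.-integrable setT (EFin \o (fun z => n%:R^-1 * (wcoord t i z.1 * wcoord t i z.2))).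
Proof. by apply: integrableRZ; exact: integrable_prodM. Qed.

Definition first_order t (z : T * T) : R :=
  chi z.1 * chi z.2 * (psi t z.1 * psi t z.2 * ncorr z).

Let first_orderE t z :
  first_order t z = \sum_i n%:R^-1 * (wcoord t i z.1 * wcoord t i z.2).
Proof.
rewrite /first_order /ncorr /inner mulr_suml !mulr_sumr; apply: eq_bigr => i _.
by rewrite /wcoord; ring.
Qed.

Lemma integrable_first_order t : (P \x P)%E.-integrable setT (EFin \o first_order t).
Proof.
have [h _] := Rintegral_sum (index_enum 'I_n) (integrable_wcoord2 t).
by rewrite (_ : first_order t = fun z => \sum_i n%:R^-1 * (wcoord t i z.1 * wcoord t i z.2))//;
  apply/funext => z; rewrite first_orderE.
Qed.

(** <X, Y> is a sum of products of coordinates, and by independence each weighted product integrates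
    to the square of a coordinate of [wmean t]. *)
Lemma Rintegral_first_order t :
  \int[(P \x P)%E]_z first_order t z = inner (wmean t) (wmean t) / n%:R.
Proof.
have [_ h] := Rintegral_sum (index_enum 'I_n) (integrable_wcoord2 t).
under eq_Rintegral do rewrite first_orderE.
rewrite h /inner mulr_suml; apply: eq_bigr => i _.
rewrite RintegralZl//; last exact: integrable_prodM.
by rewrite (Rintegral_prodM (integrable_wcoord t i) (integrable_wcoord t i)) !tnth_mktuple mulrC.
Qed.

(** The mean over H, for fixed X, of the integrand chi (cos (t S) - exp (- t^2 / 2)) of
    [cos_dev]. *)
Definition bias t w : R := chi w * (psi t w - e t).

(** The mean over H of the squared deviation, before integration over the two copies X and Y; the
    first exponent contains |X - Y|^2 / n. *)
Definition kernel t (z : T * T) : R := chi z.1 * chi z.2 *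
  (expR (- t ^+ 2 * (nsq z.1 + nsq z.2 - 2 * ncorr z) / 2) - e t * psi t z.1
   - e t * psi t z.2 + e t ^+ 2).

(** With c for [ncorr z], the kernel is chi chi' times psi psi' (exp (t^2 c) - 1) + (psi - e) (psi'
    - e). Of the exponential only the part beyond first order is estimated pointwise; the linear
    part keeps its sign for the later integration. *)
Lemma kernel_le t z : kernel t z <=
  t ^+ 2 * first_order t z + 64 * Num.min 1 (t ^+ 2) * ncorr z ^+ 2
  + bias t z.1 * bias t z.2.
Proof.
rewrite /kernel /first_order /bias /chi.
have pos : 0 <= 64 * Num.min 1 (t ^+ 2) * ncorr z ^+ 2.
  by apply: mulr_ge0; [apply: mulr_ge0 => //; exact: min1_ge0|exact: sqr_ge0].
have [h1|h1] := leP (1 / 2) (nsq z.1); last by rewrite !mul0r mulr0 add0r addr0.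
have [h2|h2] := leP (1 / 2) (nsq z.2); last by rewrite !(mulr0,mul0r) add0r addr0.
rewrite !mul1r.
have := second_order_le t h1 h2 (ncorr_le z).
set K := 64 * _ * _.
have -> : expR (- t ^+ 2 * (nsq z.1 + nsq z.2 - 2 * ncorr z) / 2) =
    psi t z.1 * psi t z.2 * expR (t ^+ 2 * ncorr z).
  by rewrite /psi -!expRD; congr expR; field.
have -> : expR (- t ^+ 2 * (nsq z.1 + nsq z.2) / 2) = psi t z.1 * psi t z.2.
  by rewrite /psi -!expRD; congr expR; field.
by lra.
Qed.

(** This is sigma_2 / sqrt n. *)
Definition delta : R := \int[P]_w `|nsq w - 1|.

Lemma integrable_delta : P.-integrable setT (EFin \o (fun w => `|nsq w - 1|)).
Proof. by apply: integrable_norm => //; apply: integrableRB => //; exact: integrable_cstR. Qed.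

Lemma bias_abs_le t w : `|bias t w| <= 2 * Num.min 1 (t ^+ 2) * `|nsq w - 1|.
Proof.
rewrite /bias /chi; have [h|h] := leP (1 / 2) (nsq w).
  by rewrite mul1r; exact: bias_le.
by rewrite mul0r normr0; apply: mulr_ge0 => //; apply: mulr_ge0 => //; exact: min1_ge0.
Qed.

Lemma measurable_bias t : measurable_fun setT (bias t).
Proof.
apply: measurable_funM; first exact: measurable_chi.
by apply: measurable_funB => //; exact: measurable_psi.
Qed.

Lemma integrable_bias t : P.-integrable setT (EFin \o bias t).
Proof.
apply: (@le_integrableR _ _ _ P _ (fun w => 2 * Num.min 1 (t ^+ 2) * `|nsq w - 1|)).
- exact: measurable_bias.
- exact: bias_abs_le.
- by apply: integrableRZ; exact: integrable_delta.
Qed.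

Lemma Rintegral_bias t : `|\int[P]_w bias t w| <= 2 * Num.min 1 (t ^+ 2) * delta.
Proof.
apply: (le_trans (le_normr_Rintegral _ (integrable_bias t))) => //.
rewrite /delta -RintegralZl//; last exact: integrable_delta.
apply: le_Rintegral => //.
- by apply: integrable_norm; exact: integrable_bias.
- by apply: integrableRZ; exact: integrable_delta.
- by move=> w _; exact: bias_abs_le.
Qed.

Lemma e_le1 t : 0 <= e t <= 1.
Proof. by rewrite expR_ge0 expR_Nsqr_le1. Qed.

Lemma measurable_kernel t : measurable_fun setT (kernel t).
Proof.
have m1 (f : T -> R) : measurable_fun setT f -> measurable_fun setT (fun z : T * T => f z.1).
  by move=> mf; exact: measurableT_comp mf measurable_fst.
have m2 (f : T -> R) : measurable_fun setT f -> measurable_fun setT (fun z : T * T => f z.2).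
  by move=> mf; exact: measurableT_comp mf measurable_snd.
apply: measurable_funM.
  by apply: measurable_funM; [apply: m1|apply: m2]; exact: measurable_chi.
apply: measurable_funD => //; apply: measurable_funB; last first.
  by apply: measurable_funM => //; apply: m2; exact: measurable_psi.
apply: measurable_funB; last first.
  by apply: measurable_funM => //; apply: m1; exact: measurable_psi.
apply: measurableT_comp => //; apply: measurable_funM => //; apply: measurable_funM => //.
apply: measurable_funB; last by apply: measurable_funM => //; exact: measurable_ncorr.
by apply: measurable_funD; [apply: m1|apply: m2]; exact: measurable_nsq.
Qed.

Lemma kernel_abs_le t z : `|kernel t z| <= 4.
Proof.
rewrite /kernel normrM.
have c0 : 0 <= chi z.1 * chi z.2 <= 1.
  by have := chi01 z.1; have := chi01 z.2; nra.
have k : 0 <= expR (- t ^+ 2 * (nsq z.1 + nsq z.2 - 2 * ncorr z) / 2) <= 1.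
  rewrite expR_ge0/= -[leRHS]expR0 ler_expR.
  have : ncorr z <= (nsq z.1 + nsq z.2) / 2 by exact: le_trans (ler_norm _) (ncorr_le z).
  by have := sqr_ge0 t; nra.
rewrite (_ : 4 = 1 * 4); last by rewrite mul1r.
apply: ler_pM => //; first by rewrite ler_norml; lra.
move: k (e_le1 t) (psi_le1 t z.1) (psi_le1 t z.2).
move: (expR _) (e t) (psi _ _) (psi _ _) => k ee p1 p2 /andP[? ?] /andP[? ?] /andP[? ?] /andP[? ?].
by rewrite ler_norml; apply/andP; split; nra.
Qed.

(** For M / n the constant is 66 = 2 + 64, from the first-order and second-order terms. The bias
    contributes 4 m^2 [delta ^+ 2], and m^2 <= m as m <= 1. *)
Lemma Rintegral_kernel t : 0 < M -> \int[P]_w nsq w = 1 ->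
  \int[(P \x P)%E]_z kernel t z <= 66 * Num.min 1 (t ^+ 2) * (M / n%:R + delta ^+ 2).
Proof.
move=> M0 nsq1; set m := Num.min 1 (t ^+ 2).
have m0 : 0 <= m := min1_ge0 t.
have m1 : m <= 1 by rewrite ge_min lexx.
have ik : (P \x P)%E.-integrable setT (EFin \o kernel t).
  apply: (@bounded_integrable _ _ _ (P \x P)%E _ 4); first exact: measurable_kernel.
  exact: kernel_abs_le.
have i1 : (P \x P)%E.-integrable setT (EFin \o (fun z => t ^+ 2 * first_order t z)).
  by apply: integrableRZ; exact: integrable_first_order.
have i2 : (P \x P)%E.-integrable setT (EFin \o (fun z => 64 * m * ncorr z ^+ 2)).
  by apply: integrableRZ; exact: integrable_ncorr_sqr.
have i3 : (P \x P)%E.-integrable setT (EFin \o (fun z => bias t z.1 * bias t z.2)).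
  by apply: integrable_prodM; exact: integrable_bias.
have : \int[(P \x P)%E]_z kernel t z <= \int[(P \x P)%E]_z
    (t ^+ 2 * first_order t z + 64 * m * ncorr z ^+ 2 + bias t z.1 * bias t z.2).
  apply: le_Rintegral => //; last by move=> z _; exact: kernel_le.
  by apply: integrableRD => //; exact: integrableRD.
rewrite RintegralD//; last exact: integrableRD.
rewrite RintegralD// RintegralZl//; last exact: integrable_first_order.
rewrite RintegralZl//; last exact: integrable_ncorr_sqr.
rewrite Rintegral_first_order (Rintegral_prodM (integrable_bias t) (integrable_bias t)).
have h1 : t ^+ 2 * (inner (wmean t) (wmean t) / n%:R) <= 2 * m * (M / n%:R).
  rewrite mulrA [leRHS]mulrA ler_pM2r ?invr_gt0//.
  apply: (@le_trans _ _ (t ^+ 2 * (M * expR (- t ^+ 2 / 2)))).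
    by rewrite ler_wpM2l ?sqr_ge0//; exact: inner_wmean_le.
  by rewrite mulrCA [leRHS]mulrC ler_pM2l//; exact: first_order_le.
have h2 : 64 * m * \int[(P \x P)%E]_z (ncorr z ^+ 2) <= 64 * m * (M / n%:R).
  rewrite ler_wpM2l ?mulr_ge0//.
  by have := Rintegral_ncorr_sqr; rewrite nsq1 mulr1.
have h3 : (\int[P]_w bias t w) * (\int[P]_w bias t w) <= 4 * m * delta ^+ 2.
  have := Rintegral_bias t; rewrite -/m; set b := \int[P]_w _ => hb.
  rewrite -expr2 -[b ^+ 2](_ : `|b| ^+ 2 = _); last by rewrite -normrX ger0_norm// sqr_ge0.
  have b2 : `|b| ^+ 2 <= (2 * m * delta) ^+ 2.
    by rewrite lerXn2r// nnegrE// (le_trans _ hb).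
  apply: (le_trans b2); have -> : (2 * m * delta) ^+ 2 = 4 * m * delta ^+ 2 * m by ring.
  by rewrite ler_piMr// mulr_ge0 ?sqr_ge0// mulr_ge0.
have d0 : 0 <= m * delta ^+ 2 by rewrite mulr_ge0// sqr_ge0.
by move: h1 h2 h3; lra.
Qed.

End kernel.

Section parametric.
Context d1 d2 (T1 : measurableType d1) (T2 : measurableType d2) (R : realType).

(** The integrals of the positive and negative parts are measurable by Tonelli, hence so is [fine]
    of their difference. *)
Lemma measurable_Rintegral_param (P : probability T2 R) (f : T1 * T2 -> R) :
  measurable_fun setT f -> measurable_fun setT (fun x => \int[P]_y f (x, y)).
Proof.
move=> mf; have mEf : measurable_fun setT (EFin \o f) by exact/measurable_EFinP.
apply: measurableT_comp; first exact: fine_measurable.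
rewrite (_ : (fun x => _) = fubini_F P ((EFin \o f)^\+)%E \- fubini_F P ((EFin \o f)^\-)%E)%E.
  apply: emeasurable_funB.
  - by apply: measurable_fun_fubini_tonelli_F => //; exact: measurable_funepos.
  - by apply: measurable_fun_fubini_tonelli_F => //; exact: measurable_funeneg.
apply/funext => x; rewrite /fubini_F [LHS]integralE; congr (_ - _)%E.
- by apply: eq_integral => y _; rewrite !funeposE.
- by apply: eq_integral => y _; rewrite !funenegE.
Qed.

End parametric.

(** * The logarithmic integral *)

Section dyadic.
Context (R : realType).
Notation gauss := (@normal_prob R 0 1).

(** Passing from m to m + 1 can change the left side only for |t| < 2^-m, where it at most doubles
    the value 2^m. Sums of indicators thus stand in for the integration of 1 / |t|. *)
Lemma dyadic_pointwise (m : nat) (t : R) :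
  `|t|^-1 * Num.min 1 (`|t| * 2 ^+ m) <=
  1 + \sum_(0 <= k < m) 2 ^+ k * (`|t| <= 2 ^- k)%R%:R.
Proof.
have [->|t0] := eqVneq t 0.
  by rewrite normr0 invr0 mul0r addr_ge0// sumr_ge0// => k _; rewrite mulr_ge0// exprn_ge0.
have t1 : 0 < `|t| by rewrite normr_gt0.
elim: m => [|m IH].
  rewrite big_geq// addr0 expr0 mulr1 ler_pdivrMl// mulr1.
  by rewrite ge_min lexx orbT.
rewrite big_nat_recr//= addrA.
have p0 : 0 < 2 ^+ m :> R by rewrite exprn_gt0.
have [h|h] := leP `|t| (2 ^- m).
  have E : `|t|^-1 * Num.min 1 (`|t| * 2 ^+ m) = 2 ^+ m.
    rewrite min_r; last by rewrite -ler_pdivlMr// mul1r.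
    by rewrite mulrA mulVf ?mul1r// gt_eqF.
  rewrite mulr1; apply: (@le_trans _ _ (2 ^+ m + 2 ^+ m)); last by rewrite lerD2r -[leLHS]E.
  have -> : 2 ^+ m + 2 ^+ m = 2 ^+ m.+1 :> R by rewrite exprS; ring.
  by rewrite ler_pdivrMl// ge_min lexx orbT.
rewrite mulr0 addr0; apply: le_trans IH; rewrite ler_wpM2l ?invr_ge0//.
rewrite [X in _ <= X]min_l; first by rewrite ge_min lexx.
by rewrite -ler_pdivrMr// mul1r ltW.
Qed.

Lemma normal_sym_le (a : R) : 0 <= a ->
  \int[gauss]_t (`|t| <= a)%R%:R <= 2 * a.
Proof.
move=> a0; have mI : measurable (`[- a, a]%classic : set R) by exact: measurable_itv.
have -> : \int[gauss]_t (`|t| <= a)%R%:R = \int[gauss]_t (\1_(`[- a, a]%classic) t : R).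
  by apply: eq_Rintegral => t _; rewrite indicE mem_setE in_itv/= ler_norml.
rewrite Rintegral_indic//.
have Naa : - a <= a by lra.
have := @normal_itv_le R (- a) a 0 Naa (fun z _ => sqr_ge0 z).
rewrite oppr0 mul0r expR0 mulr1 => h.
rewrite (_ : 2 * a = fine (a - - a)%:E); last by rewrite /=; ring.
by apply: fine_le => //; rewrite fin_num_measure.
Qed.

Lemma measurable_abs_le (a : R) : measurable_fun setT (fun t : R => (`|t| <= a)%R%:R : R).
Proof.
rewrite (_ : (fun t => _) = \1_(`[- a, a]%classic)).
  by apply: measurable_indic; exact: measurable_itv.
by apply/funext => t; rewrite indicE mem_setE in_itv/= ler_norml.
Qed.

Lemma integrable_abs_le (a : R) : gauss.-integrable setT (EFin \o (fun t => (`|t| <= a)%R%:R : R)).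
Proof.
apply: (@bounded_integrable _ _ _ gauss _ 1); first exact: measurable_abs_le.
by move=> t; case: (`|t| <= a)%R; rewrite ?normr1 ?normr0.
Qed.

Lemma measurable_dyadic (m : nat) :
  measurable_fun setT (fun t : R => `|t|^-1 * Num.min 1 (`|t| * 2 ^+ m)).
Proof.
apply: measurable_funM; first by apply: measurable_funV; exact: normr_measurable.
apply: measurable_minr => //; apply: measurable_funM => //; exact: normr_measurable.
Qed.

(** 2^k times the normal mass of [-2^-k, 2^-k] is at most 2, so each of the m dyadic scales
    contributes at most 2: the logarithm is the number of scales. *)
Lemma dyadic_integral (m : nat) :
  (\int[gauss]_t (`|t|^-1 * Num.min 1 (`|t| * 2 ^+ m))%:E <= (1 + 2 * m%:R : R)%:E)%E.
Proof.
pose f (k : nat) (t : R) : R := 2 ^+ k * (`|t| <= 2 ^- k)%R%:R.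
have If k : gauss.-integrable setT (EFin \o f k).
  by apply: integrableRZ; exact: integrable_abs_le.
have [Is Es] := Rintegral_sum (index_iota 0 m) If.
apply: (@le_trans _ _ (\int[gauss]_t (1 + \sum_(k <- index_iota 0 m) f k t)%:E)%E).
  apply: ge0_le_integral_nomeas => t _.
    by rewrite lee_fin mulr_ge0 ?invr_ge0// le_min ler01 mulr_ge0// exprn_ge0.
  by rewrite lee_fin; exact: dyadic_pointwise.
have I1 : gauss.-integrable setT (EFin \o (fun t => 1 + \sum_(k <- index_iota 0 m) f k t)).
  by apply: integrableRD => //; exact: (integrable_cstR gauss).
have fin := integrable_fin_num measurableT I1.
rewrite -(fineK fin) lee_fin -/(Rintegral _ _ _).
rewrite RintegralD//; last exact: (integrable_cstR gauss).
rewrite (Rexpectation_cst gauss) Es lerD2l.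
apply: (@le_trans _ _ (\sum_(k <- index_iota 0 m) 2)).
  apply: ler_sum => k _; rewrite /f RintegralZl//; last exact: integrable_abs_le.
  have p0 : 0 < 2 ^+ k :> R by rewrite exprn_gt0.
  rewrite -ler_pdivlMl// mulrC; apply: normal_sym_le.
  by rewrite invr_ge0 ltW.
by rewrite big_const_seq count_predT size_iota subn0 iter_addr_0 mulr_natr.
Qed.

End dyadic.

(** * The deviation of the characteristic function, averaged over H *)

Section deviation.
Context (R : realType) (n : nat) (n0 : (0 < n)%N).
Context d (T : measurableType d) (P : probability T R) (X : T -> n.-tuple R).
Context d' (T' : measurableType d') (Q : probability T' R) (H : T' -> n.-tuple R).
Hypothesis mX : measurable_fun setT X.
Hypothesis mH : measurable_fun setT H.
Hypothesis charH : forall z, \int[Q]_h cos (inner z (H h)) = expR (- (inner z z / n%:R) / 2).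
Notation gauss := (@normal_prob R 0 1).

Let chi := chi X.
Let mchi : measurable_fun setT chi. Proof. exact: measurable_chi. Qed.
Let chi01 w : 0 <= chi w <= 1. Proof. exact: chi01. Qed.
Let e (t : R) : R := expR (- t ^+ 2 / 2).
Let S h w : R := inner (X w) (H h).
Let mS h : measurable_fun setT (S h). Proof. exact: measurable_inner. Qed.

Definition deviation_sq h (t : R) : R :=
  cos_dev P chi (S h) t ^+ 2 + sin_dev P chi (S h) t ^+ 2.

Definition phase t h (z : T * T) : R := chi z.1 * chi z.2 *
  (cos (t * (S h z.1 - S h z.2)) - e t * (cos (t * S h z.1) + cos (t * S h z.2)) + e t ^+ 2).

Let integrable_cos_dev h t :
  P.-integrable setT (EFin \o (fun w => chi w * (cos (t * S h w) - e t))).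
Proof.
apply: (@chi_bounded_integrable _ _ _ P chi mchi chi01 _ 2) => //.
  by apply: measurable_funB => //; apply: measurable_funcos; exact: measurable_funM.
move=> w; apply: (le_trans (ler_normB _ _)); rewrite (_ : 2 = 1 + 1)//.
by rewrite lerD ?cos_max// ger0_norm ?expR_ge0// expR_Nsqr_le1.
Qed.

Let integrable_sin_dev h t : P.-integrable setT (EFin \o (fun w => chi w * sin (t * S h w))).
Proof.
apply: (@chi_bounded_integrable _ _ _ P chi mchi chi01 _ 1) => //; last by move=> w; exact: sin_max.
by apply: measurable_funsin; exact: measurable_funM.
Qed.

(** The square of an integral is an integral over two copies, and cos a cos b + sin a sin b merges
    the quadratic terms into cos (t (S - S')). *)
Lemma deviation_sqE h t : deviation_sq h t = \int[(P \x P)%E]_z phase t h z.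
Proof.
have Ic := integrable_cos_dev h t; have Is := integrable_sin_dev h t.
rewrite /deviation_sq !expr2 -(Rintegral_prodM Ic Ic) -(Rintegral_prodM Is Is).
rewrite -RintegralD//; [|exact: (integrable_prodM Ic Ic)|exact: (integrable_prodM Is Is)].
by apply: eq_Rintegral => z _; rewrite /phase (mulrBr t) cosB -/(e t); ring.
Qed.

Lemma phase_abs_le t h z : `|phase t h z| <= 4.
Proof.
rewrite /phase normrM (_ : 4 = 1 * 4); last by rewrite mul1r.
have c1 := chi01 z.1; have c2 := chi01 z.2.
apply: ler_pM => //; first by rewrite ler_norml; apply/andP; split; nra.
have := @cos_max R (t * (S h z.1 - S h z.2)); have := @cos_max R (t * S h z.1).
have := @cos_max R (t * S h z.2).
have : 0 <= e t <= 1 by rewrite expR_ge0 expR_Nsqr_le1.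
move: (cos _) (cos _) (cos _) (e t) => x y u v /andP[? ?].
rewrite !ler_norml => /andP[? ?] /andP[? ?] /andP[? ?]; apply/andP; split; nra.
Qed.

Lemma measurable_phase t : measurable_fun setT (fun x : T' * (T * T) => phase t x.1 x.2).
Proof.
have m1 (f : T -> R) : measurable_fun setT f ->
    measurable_fun setT (fun x : T' * (T * T) => f x.2.1).
  by move=> mf; apply: measurableT_comp mf _; exact: measurableT_comp measurable_fst measurable_snd.
have m2 (f : T -> R) : measurable_fun setT f ->
    measurable_fun setT (fun x : T' * (T * T) => f x.2.2).
  by move=> mf; apply: measurableT_comp mf _; exact: measurableT_comp measurable_snd measurable_snd.
have s1 : measurable_fun setT (fun x : T' * (T * T) => S x.1 x.2.1).
  apply: measurable_inner; last exact: measurableT_comp mH measurable_fst.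
  apply: measurableT_comp mX _; exact: measurableT_comp measurable_fst measurable_snd.
have s2 : measurable_fun setT (fun x : T' * (T * T) => S x.1 x.2.2).
  apply: measurable_inner; last exact: measurableT_comp mH measurable_fst.
  apply: measurableT_comp mX _; exact: measurableT_comp measurable_snd measurable_snd.
apply: measurable_funM; first by apply: measurable_funM; [exact: m1|exact: m2].
apply: measurable_funD => //; apply: measurable_funB.
  by apply: measurable_funcos; apply: measurable_funM => //; exact: measurable_funB.
apply: measurable_funM => //; apply: measurable_funD.
  by apply: measurable_funcos; exact: measurable_funM.
by apply: measurable_funcos; exact: measurable_funM.
Qed.

(** One formula for all cosines of [phase]: [b = -1] gives the difference of the two copies, [b = 0]
    a single copy. *)
Let Q_cos (t : R) x b y : \int[Q]_h cos (t * (inner x (H h) + b * inner y (H h))) =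
  expR (- t ^+ 2 * (inner x x + 2 * b * inner x y + b ^+ 2 * inner y y) / n%:R / 2).
Proof.
under eq_Rintegral do rewrite mulrDr mulrA -inner_tlinl.
by rewrite charH !inner_tlinl !inner_tlinr (innerC y x); congr expR; ring.
Qed.

Lemma expectation_phase t z : \int[Q]_h phase t h z = kernel X t z.
Proof.
have Ic x b y : Q.-integrable setT (EFin \o (fun h => cos (t * (inner x (H h) + b * inner y (H h))))).
  apply: (@bounded_integrable _ _ _ Q _ 1); last by move=> h; exact: cos_max.
  apply: measurable_funcos; apply: measurable_funM => //; apply: measurable_funD.
    exact: measurable_inner.
  by apply: measurable_funM => //; exact: measurable_inner.
pose c1 h := cos (t * (inner (X z.1) (H h) + -1 * inner (X z.2) (H h))).
pose c2 h := cos (t * (inner (X z.1) (H h) + 0 * inner (X z.2) (H h))).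
pose c3 h := cos (t * (inner (X z.2) (H h) + 0 * inner (X z.1) (H h))).
have I1 : Q.-integrable setT (EFin \o c1) by exact: Ic.
have I2 : Q.-integrable setT (EFin \o c2) by exact: Ic.
have I3 : Q.-integrable setT (EFin \o c3) by exact: Ic.
have I23 : Q.-integrable setT (EFin \o (fun h => e t * (c2 h + c3 h))).
  by apply: integrableRZ; exact: integrableRD.
have Ie : Q.-integrable setT (EFin \o (fun h => e t ^+ 2)) by exact: integrable_cstR.
have I123 := integrableRB I1 I23.
transitivity (chi z.1 * chi z.2 * \int[Q]_h (c1 h - e t * (c2 h + c3 h) + e t ^+ 2)).
  rewrite -RintegralZl//; last exact: integrableRD.
  by apply: eq_Rintegral => h _; rewrite /phase /c1 /c2 /c3 !mul0r !addr0 mulN1r.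
rewrite (RintegralD measurableT I123 Ie) (RintegralB measurableT I1 I23).
rewrite RintegralZl//; last exact: integrableRD.
rewrite (RintegralD measurableT I2 I3) (Rexpectation_cst Q) !Q_cos /kernel; congr (_ * _).
have nR : n%:R != 0 :> R by rewrite pnatr_eq0 -lt0n.
rewrite (mulrDr (e t)) (opprD (e t * _)) addrA.
by congr (_ - e t * _ - e t * _ + _); congr expR; rewrite /nsq /ncorr; field.
Qed.

Lemma expectation_deviation_sq t :
  \int[Q]_h deviation_sq h t = \int[(P \x P)%E]_z kernel X t z.
Proof.
under eq_Rintegral do rewrite deviation_sqE.
rewrite (@Rfubini_bounded _ _ _ _ _ Q (P \x P)%E (fun x => phase t x.1 x.2) 4)/=.
- by apply: eq_Rintegral => z _; rewrite expectation_phase.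
- exact: measurable_phase.
- by move=> x; exact: phase_abs_le.
Qed.

Lemma integrable_deviation_sq t : Q.-integrable setT (EFin \o (deviation_sq ^~ t)).
Proof.
rewrite (_ : deviation_sq ^~ t = fun h => \int[(P \x P)%E]_z phase t h z); last first.
  by apply/funext => h; exact: deviation_sqE.
have [h1 h2 _] := @bounded_fubini_hyp _ _ _ _ _ Q (P \x P)%E (fun x => phase t x.1 x.2) 4
  (measurable_phase t) (fun x => phase_abs_le t x.1 x.2).
exact: integrable_Rfubini1 h1 h2.
Qed.

Lemma deviation_sq_ge0 h t : 0 <= deviation_sq h t.
Proof. by rewrite addr_ge0 ?sqr_ge0. Qed.

Lemma measurable_deviation_sq (s : R) :
  measurable_fun setT (fun x : T' * R => deviation_sq x.1 (x.2 / s)).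
Proof.
have mchi2 : measurable_fun setT (fun y : (T' * R) * T => chi y.2).
  exact: measurableT_comp mchi measurable_snd.
have mt : measurable_fun setT (fun y : (T' * R) * T => y.1.2 / s).
  apply: measurable_funM => //; exact: measurableT_comp measurable_snd measurable_fst.
have mt2 : measurable_fun setT (fun y : (T' * R) * T => y.1.2 / s * S y.1.1 y.2).
  apply: measurable_funM => //; apply: measurable_inner.
    exact: measurableT_comp mX measurable_snd.
  apply: measurableT_comp mH _; exact: measurableT_comp measurable_fst measurable_fst.
apply: measurable_funD; apply: measurable_funX.
  apply: (measurable_Rintegral_param P (f := fun y : (T' * R) * T =>
    chi y.2 * (cos (y.1.2 / s * S y.1.1 y.2) - expR (- (y.1.2 / s) ^+ 2 / 2)))).
  apply: measurable_funM => //; apply: measurable_funB; first exact: measurable_funcos.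
  apply: measurableT_comp => //; apply: measurable_funM => //.
  by apply: measurable_funN; exact: measurable_funX.
apply: (measurable_Rintegral_param P (f := fun y : (T' * R) * T =>
  chi y.2 * sin (y.1.2 / s * S y.1.1 y.2))).
by apply: measurable_funM => //; exact: measurable_funsin.
Qed.

Variables (s beta : R).
Hypothesis beta0 : 0 < beta.
Let kappa (t : R) : R := beta * Num.min 1 `|t / s|.

(** The weight [kappa] is the expected size of the deviation, so that AM-GM
    loses only a constant and no square root has to be integrated. *)
Definition deviation_bound h : \bar R :=
  (\int[gauss]_t (`|t|^-1 * (deviation_sq h (t / s) / (2 * kappa t) + kappa t))%:E)%E.

Let kappa_ge0 t : 0 <= kappa t.
Proof. by apply: mulr_ge0; [exact: ltW|rewrite le_min ler01 normr_ge0]. Qed.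

Let integrand_ge0 h t :
  0 <= `|t|^-1 * (deviation_sq h (t / s) / (2 * kappa t) + kappa t).
Proof.
by rewrite mulr_ge0 ?invr_ge0// addr_ge0// divr_ge0 ?deviation_sq_ge0// mulr_ge0.
Qed.

Lemma deviation_bound_ge0 h : (0 <= deviation_bound h)%E.
Proof. by apply: integral_ge0 => t _; rewrite lee_fin. Qed.

Let measurable_integrand : measurable_fun setT (fun x : T' * R =>
  (`|x.2|^-1 * (deviation_sq x.1 (x.2 / s) / (2 * kappa x.2) + kappa x.2))%:E).
Proof.
have mk : measurable_fun setT (fun x : T' * R => kappa x.2).
  apply: measurable_funM => //; apply: measurable_minr => //.
  by apply: measurableT_comp => //; exact: measurable_funM.
apply/measurable_EFinP; apply: measurable_funM.
  by apply: measurable_funV; exact: measurableT_comp.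
apply: measurable_funD => //; apply: measurable_funM; first exact: measurable_deviation_sq.
by apply: measurable_funV; exact: measurable_funM.
Qed.

Lemma measurable_deviation_bound : measurable_fun setT deviation_bound.
Proof.
have h := @measurable_fun_fubini_tonelli_F _ _ _ _ R gauss _ measurable_integrand.
by apply: h => x; rewrite lee_fin.
Qed.

(** AM-GM in the form |z| <= z^2 / (2 kappa) + kappa / 2, applied to the real and to the imaginary
    part. *)
Lemma le_deviation_bound h : 0 < s ->
  (\int[gauss]_t (`|t|^-1 * (`|cos_dev P chi (S h) (t / s)| +
     `|sin_dev P chi (S h) (t / s)|))%:E <= deviation_bound h)%E.
Proof.
move=> s0; apply: ge0_le_integral_nomeas => t _.
  by rewrite lee_fin mulr_ge0 ?invr_ge0// addr_ge0.
(* [kappa] vanishes at t = 0, but there the inverse of |t| is 0 by convention and both sides are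
   0. *)
rewrite lee_fin; have [->|t0] := eqVneq t 0; first by rewrite normr0 invr0 !mul0r.
apply: ler_wpM2l; first by rewrite invr_ge0.
have k0 : 0 < kappa t.
  by rewrite mulr_gt0// lt_min ltr01 normr_gt0 mulf_neq0// invr_neq0// gt_eqF.
rewrite /deviation_sq; move: (cos_dev _ _ _ _) (sin_dev _ _ _ _) (kappa t) k0 => x y k k0.
have amgm (z : R) : `|z| <= z ^+ 2 / (2 * k) + k / 2.
  rewrite -subr_ge0 -[z ^+ 2](_ : `|z| ^+ 2 = _); last by rewrite -normrX ger0_norm// sqr_ge0.
  have -> : `|z| ^+ 2 / (2 * k) + k / 2 - `|z| = (`|z| - k) ^+ 2 / (2 * k).
    by field; rewrite gt_eqF.
  by rewrite divr_ge0 ?sqr_ge0// mulr_ge0// ltW.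
have := amgm x; have := amgm y; rewrite mulrDl; lra.
Qed.

(** As min (1, x^2) is the square of min (1, |x|), the hypothesis bounds the variance by 66 kappa^2.
    The mean of the integrand is then at most (66 / 2 + 1) kappa / |t|, whence 34, and the integral
    over t is the dyadic one since 1 / s = 2^m. *)
Lemma integral_deviation_bound (m : nat) : s = 2 ^- m ->
  (forall t, \int[Q]_h deviation_sq h t <= 66 * Num.min 1 (t ^+ 2) * beta ^+ 2) ->
  (\int[Q]_h deviation_bound h <= (34 * beta * (1 + 2 * m%:R))%:E)%E.
Proof.
move=> sE hV; rewrite /deviation_bound.
have := @fubini_tonelli _ _ _ _ _ Q gauss _ measurable_integrand => /= ->; last first.
  by move=> x; rewrite lee_fin.
apply: (@le_trans _ _ (\int[gauss]_t ((34 * beta)%:E *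
    (`|t|^-1 * Num.min 1 (`|t| * 2 ^+ m))%:E))%E).
  apply: ge0_le_integral_nomeas => t _.
    by apply: integral_ge0 => h _; rewrite lee_fin.
  have Iv : Q.-integrable setT (EFin \o (fun h =>
      `|t|^-1 * (deviation_sq h (t / s) / (2 * kappa t) + kappa t))).
    apply: integrableRZ; apply: integrableRD; last exact: integrable_cstR.
    rewrite (_ : (fun h => _) = fun h => (2 * kappa t)^-1 * deviation_sq h (t / s)).
      by apply: integrableRZ; exact: integrable_deviation_sq.
    by apply/funext => h; rewrite mulrC.
  have fin := integrable_fin_num measurableT Iv.
  rewrite -(fineK fin) -EFinM lee_fin -/(Rintegral _ _ _).
  have Iw : Q.-integrable setT (EFin \o (fun h => deviation_sq h (t / s) / (2 * kappa t))).
    rewrite (_ : (fun h => _) = fun h => (2 * kappa t)^-1 * deviation_sq h (t / s)).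
      by apply: integrableRZ; exact: integrable_deviation_sq.
    by apply/funext => h; rewrite mulrC.
  rewrite RintegralZl//; last by apply: integrableRD => //; exact: integrable_cstR.
  rewrite [leRHS]mulrCA; apply: ler_wpM2l; first by rewrite invr_ge0.
  rewrite RintegralD//; last exact: integrable_cstR.
  rewrite (Rexpectation_cst Q) RintegralZr//; last exact: integrable_deviation_sq.
  have tE : `|t| * 2 ^+ m = `|t / s|.
    by rewrite normrM sE invrK (ger0_norm (_ : 0 <= 2 ^+ m))// exprn_ge0.
  rewrite tE; have := hV (t / s).
  rewrite /kappa; set V := \int[Q]_h _; set mu := Num.min 1 `|t / s|.
  have -> : Num.min 1 ((t / s) ^+ 2) = mu ^+ 2.
    rewrite /mu; have := normr_ge0 (t / s).
    rewrite -[(t / s) ^+ 2](_ : `|t / s| ^+ 2 = _); last by rewrite -normrX ger0_norm// sqr_ge0.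
    move: `|t / s| => y y0; have [y1|y1] := leP 1 y.
      by rewrite expr1n min_l// -[leLHS](expr1n _ 2) lerXn2r// nnegrE.
    by rewrite min_r// exprn_ile1// ltW.
  have mu0 : 0 <= mu by rewrite /mu le_min ler01 normr_ge0.
  move=> Vle; move: mu0; rewrite le_eqVlt => /predU1P[<-|mu0].
    by rewrite !mulr0 invr0 mulr0 addr0.
  apply: (@le_trans _ _ (66 * mu ^+ 2 * beta ^+ 2 / (2 * (beta * mu)) + beta * mu)).
    by rewrite lerD2r ler_wpM2r// invr_ge0 !mulr_ge0// ltW.
  rewrite le_eqVlt; apply/orP; left; apply/eqP; field.
  by rewrite !gt_eqF.
rewrite ge0_integralZl//.
- rewrite [leRHS]EFinM; apply: lee_wpmul2l; last exact: dyadic_integral.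
  by rewrite lee_fin mulr_ge0// ltW.
- by apply/measurable_EFinP; exact: measurable_dyadic.
- by rewrite lee_fin mulr_ge0// ltW.
Qed.

End deviation.

(** * From the deviation to the distribution function at a fixed H *)

Section pointwise.
Context (R : realType) (n : nat) (n0 : (0 < n)%N).
Context d (T : measurableType d) (P : probability T R) (X : T -> n.-tuple R).
Context d' (T' : measurableType d') (H : T' -> n.-tuple R).
Hypothesis mX : measurable_fun setT X.
Hypothesis intX2 : P.-integrable setT (EFin \o nsq X).
Hypothesis intXz : forall z, P.-integrable setT (EFin \o (fun w => inner (X w) z ^+ 2)).

(** The integrand is split by the weights chi and 1 - chi. The first part is the smoothing estimate;
    where chi = 0, |X|^2 / n differs from 1 by more than 1/2, so the second part is at most 2 E |
    |X|^2 / n - 1 |. *)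
Lemma pointwise_bound (s v beta : R) h x : 0 < s -> 0 < v -> 0 < beta ->
  (`|\int[P]_w (inner (X w) (H h) <= x)%R%:R - PhiR x|%:E <=
   deviation_bound P X H s beta h + (2 * delta P X + v ^- 2 + 2 * s * v)%:E)%E.
Proof.
move=> s0 v0 b0; have L0 := deviation_bound_ge0 P X H s b0 h.
have [Lfin|] := boolP (deviation_bound P X H s beta h \is a fin_num); last first.
  rewrite ge0_fin_numE// -leNgt leye_eq => /eqP ->.
  by rewrite addye ?leey.
have mc := measurable_chi mX; have c01 := chi01 X.
have IS := integrable_coord mX intXz (H h).
set S := (fun w => inner (X w) (H h)) in IS.
have mS : measurable_fun setT S by apply/measurable_EFinP; exact: measurable_int IS.
have hB y : `|\int[P]_w (chi X w * (smooth_step ((y - S w) / s) - smooth_Phi s y))|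
    <= fine (deviation_bound P X H s beta h).
  rewrite -lee_fin fineK//.
  apply: (le_trans (smoothed_deviation_le mc c01 IS y s0)).
  exact: le_deviation_bound.
have h1 := weighted_smoothing mc c01 IS x s0 v0 hB.
rewrite -(fineK Lfin) -EFinD lee_fin.
have I1 : P.-integrable setT (EFin \o (fun w => (S w <= x)%R%:R - PhiR x)).
  apply: (@bounded_integrable _ _ _ P _ 1).
    by apply: measurable_funB => //; exact: measurable_le_indic.
  move=> w; have := PhiR_ge0 x; have := PhiR_le1 x.
  by case: (S w <= x)%R => /=; rewrite ler_norml; lra.
have I2 : P.-integrable setT (EFin \o (fun w => chi X w * ((S w <= x)%R%:R - PhiR x))).
  apply: (@le_integrableR _ _ _ P _ (fun w => `|(S w <= x)%R%:R - PhiR x|)).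
  - apply: measurable_funM => //; apply: measurable_funB => //; exact: measurable_le_indic.
  - by move=> w; rewrite normrM ler_piMl// ger0_norm; have /andP[] := c01 w.
  - exact: integrable_norm.
have I3 : P.-integrable setT (EFin \o (fun w => (1 - chi X w) * ((S w <= x)%R%:R - PhiR x))).
  rewrite (_ : (fun w => _) = (fun w => ((S w <= x)%R%:R - PhiR x) - chi X w * ((S w <= x)%R%:R - PhiR x))).
    exact: integrableRB.
  by apply/funext => w; ring.
have Ile : P.-integrable setT (EFin \o (fun w => (S w <= x)%R%:R)).
  apply: (@bounded_integrable _ _ _ P _ 1); first exact: measurable_le_indic.
  by move=> w; case: (S w <= x)%R; rewrite ?normr1 ?normr0.
have E : \int[P]_w (S w <= x)%R%:R - PhiR x =
    \int[P]_w (chi X w * ((S w <= x)%R%:R - PhiR x)) +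
    \int[P]_w ((1 - chi X w) * ((S w <= x)%R%:R - PhiR x)).
  rewrite -RintegralD// -[X in _ - X = _](Rexpectation_cst P) -RintegralB//.
    by apply: eq_Rintegral => w _; ring.
  exact: integrable_cstR.
rewrite E; apply: (le_trans (ler_normD _ _)).
have h2 : `|\int[P]_w ((1 - chi X w) * ((S w <= x)%R%:R - PhiR x))| <= 2 * delta P X.
  apply: (le_trans (le_normr_Rintegral _ I3)) => //.
  rewrite /delta -RintegralZl//; last exact: integrable_delta.
  apply: le_Rintegral => //; first exact: integrable_norm.
    by apply: integrableRZ; exact: integrable_delta.
  move=> w _; rewrite normrM /chi; have [a2|a2] := leP (1 / 2) (nsq X w).
    by rewrite subrr normr0 mul0r mulr_ge0.
  rewrite subr0 normr1 mul1r (@le_trans _ _ 1)//.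
    have := PhiR_ge0 x; have := PhiR_le1 x.
    by case: (S w <= x)%R => /=; rewrite ler_norml; lra.
  by rewrite ltr0_norm; lra.
by move: h1 h2; rewrite /S; lra.
Qed.

End pointwise.

(** * Gaussian vectors and rotations *)

Section gaussian_vector.
Context (R : realType).
Notation gauss := (@normal_prob R 0 1).

(** The variance of Z^2 for a standard normal Z (equal to 2), kept symbolic up to the final
    constant. *)
Definition normal_fourth : R := \int[gauss]_x ((x ^+ 2 - 1) ^+ 2).

Lemma integrable_normal_fourth :
  gauss.-integrable setT (EFin \o (fun x => (x ^+ 2 - 1) ^+ 2)).
Proof.
apply: (@integrable_normal_le4 _ _ 1).
  by apply: measurable_funX; apply: measurable_funB => //; exact: measurable_funX.
move=> x; rewrite mul1r ger0_norm ?sqr_ge0//.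
have -> : (x ^+ 2 - 1) ^+ 2 = x ^+ 4 + 1 - 2 * x ^+ 2 by ring.
by have := sqr_ge0 x; lra.
Qed.

Lemma integrable_normal_centered_sqr :
  gauss.-integrable setT (EFin \o (fun x => x ^+ 2 - 1)).
Proof.
by apply: integrableRB; [exact: integrable_normal_sqr|exact: (integrable_cstR gauss)].
Qed.

Lemma normal_centered_sqr : \int[gauss]_x (x ^+ 2 - 1) = 0.
Proof.
rewrite RintegralB//; [|exact: integrable_normal_sqr|exact: (integrable_cstR gauss)].
by rewrite normal_sqr (Rexpectation_cst gauss) subrr.
Qed.

(** Normality is recorded through the real part of the characteristic function; the moments of |g|^2
    - n control the radius. *)
Definition gaussian_vector d (T : measurableType d) (P : probability T R) n
    (g : T -> n.-tuple R) : Prop :=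
  [/\ measurable_fun setT g,
   forall u, \int[P]_w cos (inner u (g w)) = expR (- inner u u / 2),
   P.-integrable setT (EFin \o (fun w => inner (g w) (g w) - n%:R)),
   \int[P]_w (inner (g w) (g w) - n%:R) = 0 &
   P.-integrable setT (EFin \o (fun w => (inner (g w) (g w) - n%:R) ^+ 2)) /\
   \int[P]_w ((inner (g w) (g w) - n%:R) ^+ 2) = n%:R * normal_fourth].

Lemma inner_cons n (u : n.+1.-tuple R) (y : R) (x : n.-tuple R) :
  inner u [tuple of y :: x] =
  tnth u ord0 * y + inner [tuple tnth u (lift ord0 i) | i < n] x.
Proof.
rewrite /inner big_ord_recl tnth0; congr (_ + _); apply: eq_bigr => i _.
by rewrite tnthS tnth_mktuple.
Qed.

Lemma inner_recl n (u v : n.+1.-tuple R) :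
  inner u v = tnth u ord0 * tnth v ord0 +
  inner [tuple tnth u (lift ord0 i) | i < n] [tuple tnth v (lift ord0 i) | i < n].
Proof.
by rewrite /inner big_ord_recl; congr (_ + _); apply: eq_bigr => i _; rewrite !tnth_mktuple.
Qed.

Lemma inner_cons_cons n (y : R) (x : n.-tuple R) :
  inner [tuple of y :: x] [tuple of y :: x] = y ^+ 2 + inner x x.
Proof.
by rewrite /inner big_ord_recl tnth0 expr2; congr (_ + _); apply: eq_bigr => i _; rewrite tnthS.
Qed.

(** A new independent coordinate Z adds Z^2 - 1 to |g|^2 - n. As Z^2 - 1 is centered, the cross term
    integrates to 0 and the variances add. *)
Lemma gaussian_vectorS d (T : measurableType d) (P : probability T R) n
    (g : T -> n.-tuple R) : gaussian_vector P g ->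
  gaussian_vector (P \x gauss)%E
    (fun z : T * R => [tuple of z.2 :: g z.1] : n.+1.-tuple R).
Proof.
move=> [mg charg I1 E1 [I2 E2]].
have m1 : measurable_fun setT (fun z : T * R => g z.1) by exact: measurableT_comp mg measurable_fst.
have mcons : measurable_fun setT (fun z : T * R => [tuple of z.2 :: g z.1] : n.+1.-tuple R).
  exact: measurable_cons measurable_snd m1.
have Ic : gauss.-integrable setT (EFin \o (cst 1 : R -> R)) by exact: (integrable_cstR gauss).
have IP : P.-integrable setT (EFin \o (cst 1 : T -> R)) by exact: integrable_cstR.
have J1 := integrable_prodM I1 Ic; have J2 := integrable_prodM IP integrable_normal_centered_sqr.
have J11 := integrable_prodM I2 Ic; have J22 := integrable_prodM IP integrable_normal_fourth.
have J12 := integrable_prodM I1 integrable_normal_centered_sqr.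
have D1 : (fun z : T * R => inner [tuple of z.2 :: g z.1] [tuple of z.2 :: g z.1] - n.+1%:R) =
    (fun z => (inner (g z.1) (g z.1) - n%:R) * cst 1 z.2 + cst 1 z.1 * (z.2 ^+ 2 - 1)).
  by apply/funext => z; rewrite inner_cons_cons -natr1 /=; ring.
have D2 : (fun z : T * R => (inner [tuple of z.2 :: g z.1] [tuple of z.2 :: g z.1] - n.+1%:R) ^+ 2) =
    (fun z => (inner (g z.1) (g z.1) - n%:R) ^+ 2 * cst 1 z.2 + cst 1 z.1 * (z.2 ^+ 2 - 1) ^+ 2
      + 2 * ((inner (g z.1) (g z.1) - n%:R) * (z.2 ^+ 2 - 1))).
  by apply/funext => z; rewrite inner_cons_cons -natr1 /=; ring.
have Ec : \int[gauss]_x (cst 1 : R -> R) x = 1 by exact: (Rexpectation_cst gauss).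
have EP : \int[P]_x (cst 1 : T -> R) x = 1 by exact: Rexpectation_cst.
split=> //.
- move=> u.
  under eq_Rintegral do rewrite inner_cons.
  rewrite -(@Rfubini_bounded1 _ _ _ _ _ P gauss
    (fun z => cos (tnth u ord0 * z.2 + inner [tuple tnth u (lift ord0 i) | i < n] (g z.1))) 1); last 2 first.
  - apply: measurable_funcos; apply: measurable_funD; first exact: measurable_funM.
    exact: measurable_inner.
  - by move=> z; exact: cos_max.
  under eq_Rintegral => w _.
    under eq_Rintegral do rewrite /= addrC.
    rewrite normal_cos.
    over.
  rewrite RintegralZr//; last first.
    apply: (@bounded_integrable _ _ _ P _ 1); last by move=> w; exact: cos_max.
    by apply: measurable_funcos; exact: measurable_inner.
  rewrite charg -expRD (inner_recl u u); congr expR; ring.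
- rewrite D1; exact: integrableRD.
- rewrite D1 RintegralD// (Rintegral_prodM I1 Ic) (Rintegral_prodM IP integrable_normal_centered_sqr).
  by rewrite E1 normal_centered_sqr mul0r mulr0 addr0.
- rewrite D2; have J3 := integrableRZ 2 J12; have J4 := integrableRD J11 J22.
  split; first exact: integrableRD J4 J3.
  rewrite (RintegralD measurableT J4 J3) (RintegralD measurableT J11 J22) RintegralZl//.
  rewrite (Rintegral_prodM I2 Ic) (Rintegral_prodM IP integrable_normal_fourth).
  rewrite (Rintegral_prodM I1 integrable_normal_centered_sqr).
  rewrite normal_centered_sqr mulr0 mulr0 addr0 Ec EP mulr1 mul1r E2 -natr1 -/normal_fourth.
  by ring.
Qed.

(** Coordinates are adjoined one at a time by products with the normal law, so the underlying space
    depends on n; hence the existential over measurable types. *)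
Lemma gaussian_vector_exists n : exists d (T : measurableType d) (P : probability T R)
  (g : T -> n.-tuple R), gaussian_vector P g.
Proof.
elim: n => [|n [d [T [P [g Hg]]]]].
  exists _, (measurableTypeR R), (gauss : probability (measurableTypeR R) R), (cst [tuple]).
  have E (u v : 0.-tuple R) : inner u v = 0 by rewrite /inner big_ord0.
  split; first exact: measurable_cst.
  - move=> u; under eq_Rintegral do rewrite E cos0.
    by rewrite (Rexpectation_cst gauss) E oppr0 mul0r expR0.
  - rewrite (_ : (fun w => _) = cst 0); first exact: (integrable_cstR gauss).
    by apply/funext => w; rewrite E subrr.
  - under eq_Rintegral do rewrite E subrr.
    by rewrite (Rexpectation_cst gauss).
  - split; last first.
      under eq_Rintegral do rewrite E subrr expr0n.
      by rewrite (Rexpectation_cst gauss) mul0r.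
    rewrite (_ : (fun w => _) = cst 0); first exact: (integrable_cstR gauss).
    by apply/funext => w; rewrite E subrr expr0n.
exists _, (T * measurableTypeR R)%type, (P \x gauss)%E,
  (fun z : T * R => [tuple of z.2 :: g z.1]).
exact: gaussian_vectorS Hg.
Qed.

End gaussian_vector.

(** * Reflections and the characteristic function of H *)

Section rotation.
Context (R : realType) (n : nat).
Implicit Types x y z : n.-tuple R.

Definition tcol x : 'cV[R]_n := \col_i tnth x i.

Lemma tcol_inner x y : (tcol x)^T *m tcol y = (inner x y)%:M.
Proof.
apply/matrixP => i j; rewrite !mxE !ord1 eqxx mulr1n; apply: eq_bigr => k _.
by rewrite !mxE.
Qed.

(** The reflection through the hyperplane orthogonal to x. Rotation invariance enters through such
    reflections alone, as they exchange any two vectors of equal norm. *)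
Definition householder x : 'M[R]_n :=
  1%:M - (2 / inner x x) *: (tcol x *m (tcol x)^T).

Lemma householder_orthogonal x : inner x x != 0 ->
  householder x *m (householder x)^T = 1%:M.
Proof.
move=> x0; have -> : (householder x)^T = householder x.
  by rewrite /householder linearB /= trmx1 linearZ /= trmx_mul trmxK.
rewrite /householder; set V := tcol x *m _; set c := _ / _.
have VV : V *m V = inner x x *: V.
  by rewrite /V mulmxA -(mulmxA (tcol x)) tcol_inner mul_mx_scalar scalemxAl.
rewrite mulmxBl mul1mx mulmxBr mulmx1 -scalemxAl -scalemxAr VV !scalerA.
have -> : c * c * inner x x = c + c by rewrite /c; field.
by rewrite scalerDl opprB addrK subrK.
Qed.

Lemma inner_mxact x (A : 'M[R]_n) y :
  inner x (mxact A y) = ((tcol x)^T *m A *m tcol y) 0 0.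
Proof.
rewrite -mulmxA mxE; apply: eq_bigr => i _; rewrite tnth_mktuple !mxE; congr (_ * _).
by apply: eq_bigr => j _; rewrite !mxE.
Qed.

Lemma inner_eq0 x : inner x x = 0 -> forall i, tnth x i = 0.
Proof.
move=> /eqP; rewrite psumr_eq0; last by move=> i _; rewrite -expr2 sqr_ge0.
by move=> /allP h i; have := h i (mem_index_enum _); rewrite -expr2 sqrf_eq0 => /eqP.
Qed.

(** For v = x - y and |x| = |y| one has |v|^2 = 2 <x, v>, so the reflection along v sends x to y. *)
Lemma inner_householder x y z : inner x x = inner y y -> x != y ->
  inner x (mxact (householder (tlin 1 x (-1) y)) z) = inner y z.
Proof.
move=> xy xny; set v := tlin 1 x (-1) y.
have vv : inner v v = 2 * inner x v.
  rewrite /v !inner_tlinl !inner_tlinr (innerC y x) -xy; ring.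
have v0 : inner v v != 0.
  apply: contra xny => /eqP /inner_eq0 h; apply/eqP/eq_from_tnth => i.
  by have := h i; rewrite tnth_mktuple mul1r mulN1r => /eqP; rewrite subr_eq0 => /eqP.
rewrite inner_mxact /householder mulmxBr mulmxBl mulmx1 tcol_inner.
have -> : (tcol x)^T *m ((2 / inner v v) *: (tcol v *m (tcol v)^T)) *m tcol z =
    (2 / inner v v * (inner x v * inner v z))%:M.
  rewrite -scalemxAr -scalemxAl mulmxA tcol_inner -mulmxA tcol_inner.
  by rewrite -scalar_mxM scale_scalar_mx.
rewrite !mxE !eqxx !mulr1n.
have -> : 2 / inner v v * (inner x v * inner v z) = inner v z.
  have xv0 : inner x v != 0 by apply: contra v0 => /eqP h; rewrite vv h mulr0.
  by rewrite vv; field.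
by rewrite {1}/v inner_tlinl; ring.
Qed.

Lemma measurable_mxact (A : 'M[R]_n) : measurable_fun setT (mxact A : n.-tuple R -> n.-tuple R).
Proof.
apply/measurable_fun_tnthP => i.
rewrite (_ : _ \o _ = fun x => \sum_(j < n) A i j * tnth x j).
  by apply: measurable_sum => j; apply: measurable_funM => //; exact: measurable_tnth.
by apply/funext => x /=; rewrite tnth_mktuple.
Qed.

Variables (mu : probability (n.-tuple R) R).
Hypothesis unif : uniform_sphere mu.

Lemma uniform_sphere_rot (O : 'M[R]_n) (f : n.-tuple R -> R) (M : R) :
  O *m O^T = 1%:M -> measurable_fun setT f -> (forall x, `|f x| <= M) ->
  \int[mu]_x f (mxact O x) = \int[mu]_x f x.
Proof.
move=> OO mf fM; congr fine.
have mO := measurable_mxact O.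
have mEf : measurable_fun setT (EFin \o f) by exact/measurable_EFinP.
have := @integral_pushforward _ _ _ _ R _ mO mu setT (EFin \o f) mEf.
rewrite preimage_setT => <- //; last first.
  by apply: (@bounded_integrable _ _ _ mu _ M) => //; exact: measurableT_comp mf mO.
apply: eq_measure_integral => A mA _.
by rewrite /pushforward; case: unif => _; apply.
Qed.

Lemma uniform_sphere_cos x y : inner x x = inner y y ->
  \int[mu]_t cos (inner x t) = \int[mu]_t cos (inner y t).
Proof.
move=> xy; have [->//|xny] := eqVneq x y.
have d0 : inner (tlin 1 x (-1) y) (tlin 1 x (-1) y) != 0.
  apply: contra xny => /eqP /inner_eq0 h; apply/eqP/eq_from_tnth => i.
  by have := h i; rewrite tnth_mktuple mul1r mulN1r => /eqP; rewrite subr_eq0 => /eqP.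
rewrite -(@uniform_sphere_rot _ (fun t => cos (inner x t)) 1 (householder_orthogonal d0)).
- by apply: eq_Rintegral => t _; rewrite inner_householder.
- by apply: measurable_funcos; exact: measurable_inner.
- by move=> t; exact: cos_max.
Qed.

Definition tscale (a : R) x : n.-tuple R := tlin a x 0 x.

Lemma inner_tscalel a x y : inner (tscale a x) y = a * inner x y.
Proof. by rewrite inner_tlinl mul0r addr0. Qed.

Lemma inner_tscaler a x y : inner y (tscale a x) = a * inner y x.
Proof. by rewrite innerC inner_tscalel innerC. Qed.

Lemma measurable_sphere : measurable (sphere R n).
Proof.
rewrite (_ : sphere R n = (fun x => inner x x) @^-1` [set 1]).
  rewrite -[X in measurable X]setTI; apply: measurable_inner => //.
apply/seteqP; split => x /=; rewrite /sphere /= /enorm.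
  by move=> h; rewrite -[LHS]sqr_sqrtr ?inner_ge0// h expr1n.
by move=> ->; rewrite sqrtr1.
Qed.

Lemma uniform_sphere_ae : {ae mu, forall t, inner t t = 1}.
Proof.
case: unif => m1 _; exists (~` sphere R n); split.
- exact: measurableC measurable_sphere.
- by rewrite probability_setC ?m1 ?subee//; exact: measurable_sphere.
- move=> t /=; apply: contra_not; rewrite /sphere /= /enorm => h.
  by rewrite -[LHS]sqr_sqrtr ?inner_ge0// h expr1n.
Qed.

Context d (T : measurableType d) (P : probability T R) (g : T -> n.-tuple R).
Hypothesis Hg : gaussian_vector P g.
Hypothesis n0 : (0 < n)%N.

Definition radius (w : T) : R := enorm (g w) / Num.sqrt n%:R.

Definition polar (h : n.-tuple R * T) : n.-tuple R := tscale (radius h.2) h.1.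

Lemma measurable_radius : measurable_fun setT radius.
Proof.
case: Hg => mg _ _ _ _; apply: measurable_funM => //.
have ms := continuous_measurable_fun (@sqrt_continuous R).
exact: (measurableT_comp ms (measurable_inner mg mg)).
Qed.

Lemma measurable_polar : measurable_fun setT polar.
Proof.
apply/measurable_fun_tnthP => i.
rewrite (_ : _ \o _ = fun h : n.-tuple R * T => radius h.2 * tnth h.1 i); last first.
  by apply/funext => h /=; rewrite tnth_mktuple mul0r addr0.
apply: measurable_funM.
  exact: measurableT_comp measurable_radius measurable_snd.
exact: measurableT_comp (measurable_tnth i) measurable_fst.
Qed.

Lemma radius_sqr w : radius w ^+ 2 = inner (g w) (g w) / n%:R.
Proof. by rewrite exprMn exprVn enorm_sqr sqr_sqrtr. Qed.

(** <z, H> = <r z, theta> with r = |g| / sqrt n, and r z has the same norm as k g for k = |z| / sqrt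
    n. By rotation invariance r z may be replaced by k g in the mean over theta. For fixed theta the
    mean over g is then explicit, and |theta| = 1 almost surely. *)
Lemma polar_char z :
  \int[(mu \x P)%E]_h cos (inner z (polar h)) = expR (- (inner z z / n%:R) / 2).
Proof.
have [mg charg _ _ _] := Hg.
pose k : R := Num.sqrt (inner z z / n%:R).
have k2 : k ^+ 2 = inner z z / n%:R by rewrite sqr_sqrtr// divr_ge0// inner_ge0.
have mf : measurable_fun setT (fun h => cos (inner z (polar h))).
  by apply: measurable_funcos; apply: measurable_inner => //; exact: measurable_polar.
rewrite -(Rfubini_bounded1 mu P mf (fun h => cos_max _)) (Rfubini_bounded mu P mf (fun h => cos_max _)).
transitivity (\int[P]_w \int[mu]_t cos (inner (tscale k (g w)) t)).
  apply: eq_Rintegral => w _.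
  rewrite -(uniform_sphere_cos (_ : inner (tscale (radius w) z) (tscale (radius w) z) = _)).
    by apply: eq_Rintegral => t _; rewrite /polar inner_tscalel inner_tscaler.
  rewrite !inner_tscalel !inner_tscaler.
  transitivity (radius w ^+ 2 * inner z z); first by ring.
  by rewrite radius_sqr; transitivity (k ^+ 2 * inner (g w) (g w)); [rewrite k2|]; ring.
pose f (x : n.-tuple R * T) := cos (inner (tscale k (g x.2)) x.1).
have mf2 : measurable_fun setT f.
  apply: measurable_funcos; rewrite (_ : (fun h => _) = fun h : n.-tuple R * T => k * inner (g h.2) h.1).
    apply: measurable_funM => //; apply: measurable_inner => //.
    exact: measurableT_comp mg measurable_snd.
  by apply/funext => h; rewrite inner_tscalel.
rewrite -(Rfubini_bounded mu P mf2 (fun h => cos_max _)).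
transitivity (\int[mu]_t expR (- (k ^+ 2 * inner t t) / 2)).
  apply: eq_Rintegral => t _; rewrite -[k ^+ 2 * _](_ : inner (tscale k t) (tscale k t) = _).
    rewrite -charg; apply: eq_Rintegral => w _.
    by rewrite /f inner_tscalel inner_tscalel innerC.
  by rewrite inner_tscalel inner_tscaler mulrA expr2.
transitivity (\int[mu]_t (cst (expR (- (inner z z / n%:R) / 2)) t)).
  congr fine; apply: ae_eq_integral => //.
  - apply/measurable_EFinP; apply: measurableT_comp => //; apply: measurable_funM => //.
    by apply: measurable_funN; apply: measurable_funM => //; exact: measurable_inner.
  - exact/measurable_EFinP/measurable_cst.
  - have [N [mN N0 sub]] := uniform_sphere_ae; exists N; split=> // t /= h.
    by apply: sub => /= t1; apply: h => _; rewrite t1 mulr1 k2.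
exact: Rexpectation_cst.
Qed.

Lemma radius_moment : \int[P]_w ((radius w ^+ 2 - 1) ^+ 2) = normal_fourth R / n%:R.
Proof.
have [_ _ _ _ [I2 E2]] := Hg.
transitivity (\int[P]_w (n%:R ^- 2 * (inner (g w) (g w) - n%:R) ^+ 2)).
  apply: eq_Rintegral => w _; rewrite radius_sqr; field.
  by rewrite pnatr_eq0 -lt0n.
rewrite RintegralZl// E2; field.
by rewrite pnatr_eq0 -lt0n.
Qed.

Lemma integrable_radius_moment : P.-integrable setT (EFin \o (fun w => (radius w ^+ 2 - 1) ^+ 2)).
Proof.
have [_ _ _ _ [I2 E2]] := Hg.
rewrite (_ : (fun w => _) = fun w => n%:R ^- 2 * (inner (g w) (g w) - n%:R) ^+ 2).
  exact: integrableRZ.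
apply/funext => w; rewrite radius_sqr; field.
by rewrite pnatr_eq0 -lt0n.
Qed.

End rotation.

(** * The averaged bound *)

Lemma inner_sqr_le (R : realType) n (x z : n.-tuple R) :
  inner x z ^+ 2 <= inner x x * inner z z.
Proof.
have := inner_ge0 z; rewrite le_eqVlt => /predU1P[z0|z0].
  rewrite -z0 mulr0 /inner big1 ?expr0n// => i _.
  by rewrite (inner_eq0 (esym z0)) mulr0.
have := inner_ge0 (tlin (inner z z) x (- inner x z) z).
rewrite !inner_tlinl !inner_tlinr (innerC z x).
set a := inner x x; set b := inner x z; set q := inner z z.
have -> : q * (q * a + - b * b) + - b * (q * b + - b * q) = q * (a * q - b ^+ 2) by ring.
by rewrite pmulr_rge0// subr_ge0.
Qed.

Section log.
Context (R : realType).

Lemma ln2_ge : 1 / 2 <= ln 2 :> R.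
Proof.
rewrite -ler_expR lnK ?posrE//.
have := expR_ge1Dx (- (1 / 2) : R); have := expRxMexpNx_1 (1 / 2 : R).
by have := expR_gt0 (1 / 2 : R); nra.
Qed.

Lemma ln_nat_ge (n : nat) : (2 <= n)%N -> 1 / 2 <= ln n%:R :> R.
Proof.
move=> n2; apply: (le_trans ln2_ge).
by rewrite ler_ln ?posrE ?ltr0n ?ler_nat// (leq_trans _ n2).
Qed.

(** For m = [up_log 2 n], 2^(m-1) < n and ln 2 >= 1/2 give m - 1 <= 2 ln n. So 1 + 2 m <= 3 + 4 ln
    n, and 3 <= 6 ln n because ln n >= 1/2. *)
Lemma up_log_le (n : nat) : (2 <= n)%N -> 1 + 2 * (up_log 2 n)%:R <= 10 * ln n%:R :> R.
Proof.
move=> n2; have l2 := ln_nat_ge n2.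
have /andP[h _] := up_log_bounds (isT : (1 < 2)%N) n2.
have h2 : (up_log 2 n).-1%:R * ln 2 <= ln n%:R :> R.
  rewrite mulr_natl -lnXn// ler_ln ?posrE ?exprn_gt0 ?ltr0n ?(leq_trans _ n2)//.
  by rewrite -natrX ler_nat ltnW.
have m1 : (0 < up_log 2 n)%N by rewrite up_log_gt0.
have l22 := ln2_ge; rewrite -(prednK m1) -natr1 /=.
have a0 : 0 <= (up_log 2 n).-1%:R :> R by [].
have : (up_log 2 n).-1%:R / 2 <= ln n%:R :> R.
  by apply: le_trans h2; rewrite ler_wpM2l//; move: l22; lra.
lra.
Qed.

End log.

(** * Second moments of X, and the quantities of the theorem as real numbers *)

Section weighted_sums.
Context (R : realType) (n : nat) (n2 : (2 <= n)%N).
Context (mu : probability (n.-tuple R) R) (unif : uniform_sphere mu).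
Context (d : measure_display) (T : measurableType d) (P : probability T R).
Context (X : {RV P >-> n.-tuple R}).
Hypothesis EX : ('E_P[fun w => (enorm (X w) ^+ 2)%R] = n%:R%:E)%E.

Let n0 : (0 < n)%N. Proof. exact: leq_trans n2. Qed.
Let nR0 : 0 < n%:R :> R. Proof. by rewrite ltr0n. Qed.
Let mX : measurable_fun setT X. Proof. exact: measurable_funPT. Qed.

Let intXX : P.-integrable setT (EFin \o (fun w => inner (X w) (X w))).
Proof.
apply/integrableP; split.
  by apply/measurable_EFinP; exact: measurable_inner.
rewrite (_ : (\int[P]_x _)%E = n%:R%:E) ?ltry// -EX unlock.
by apply: eq_integral => w _ /=; rewrite ger0_norm ?inner_ge0// enorm_sqr.
Qed.

Lemma nsq_integrable : P.-integrable setT (EFin \o nsq X).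
Proof.
rewrite (_ : nsq X = fun w => n%:R^-1 * inner (X w) (X w)); first exact: integrableRZ.
by apply/funext => w; rewrite /nsq mulrC.
Qed.

Lemma nsq_mean : \int[P]_w nsq X w = 1.
Proof.
under eq_Rintegral do rewrite /nsq mulrC.
rewrite RintegralZl//.
have -> : \int[P]_w inner (X w) (X w) = n%:R.
  rewrite /Rintegral -[RHS]/(fine n%:R%:E) -EX unlock; congr fine.
  by apply: eq_integral => w _; rewrite enorm_sqr.
by rewrite mulVf// gt_eqF.
Qed.

Lemma inner_sqr_integrable z : P.-integrable setT (EFin \o (fun w => inner (X w) z ^+ 2)).
Proof.
apply: (@le_integrableR _ _ _ P _ (fun w => inner z z * inner (X w) (X w))).
- by apply: measurable_funX; exact: measurable_inner.
- by move=> w; rewrite ger0_norm ?sqr_ge0// mulrC inner_sqr_le.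
- exact: integrableRZ.
Qed.

Section finite_M2.
Variable r : R.
Hypothesis M2r : M2 X = r%:E.

(** Homogeneity reduces to unit vectors, where it is the definition of the supremum; z = 0 has no
    direction and is treated apart. *)
Lemma second_moment_le z : \int[P]_w (inner (X w) z ^+ 2) <= r ^+ 2 * inner z z.
Proof.
have := inner_ge0 z; rewrite le_eqVlt => /predU1P[z0|z0].
  rewrite -z0 mulr0 -[leRHS](Rexpectation_cst P); apply: le_Rintegral => //.
  - exact: inner_sqr_integrable.
  - exact: integrable_cstR.
  move=> w _; rewrite /inner big1 ?expr0n// => i _.
  by rewrite (inner_eq0 (esym z0)) mulr0.
pose k := (Num.sqrt (inner z z))^-1; pose t := tscale k z.
have k2 : k ^+ 2 * inner z z = 1 by rewrite exprVn sqr_sqrtr ?ltW// mulVf// gt_eqF.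
have St : sphere R n t.
  rewrite /sphere /= /enorm inner_tscalel inner_tscaler mulrA -expr2 k2.
  exact: sqrtr1.
pose v := \int[P]_w (inner (X w) t ^+ 2).
have v0 : 0 <= v by apply: Rintegral_ge0 => w _; exact: sqr_ge0.
have Ev : ('E_P[fun w => (inner (X w) t ^+ 2)%R] = v%:E)%E.
  by rewrite unlock fineK// integrable_fin_num//; exact: inner_sqr_integrable.
have : ('E_P[fun w => (inner (X w) t ^+ 2)%R] `^ 2^-1 <= M2 X)%E.
  by apply: ereal_sup_ubound; exists t.
rewrite M2r Ev poweR_EFin powR12_sqrt// lee_fin => vr.
have vr2 : v <= r ^+ 2.
  by rewrite -[leLHS]sqr_sqrtr// lerXn2r ?nnegrE ?sqrtr_ge0// (le_trans _ vr) ?sqrtr_ge0.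
have -> : \int[P]_w (inner (X w) z ^+ 2) = inner z z * v.
  rewrite /v -RintegralZl//; last exact: inner_sqr_integrable.
  apply: eq_Rintegral => w _; rewrite inner_tscaler exprMn mulrA (mulrC (inner z z)) k2.
  by rewrite mul1r.
by rewrite mulrC ler_wpM2r// ltW.
Qed.

(** The average over the n coordinate directions of E <X, e_i>^2 is E |X|^2 / n = 1, and each of
    these moments is at most r^2. *)
Lemma M2_sqr_ge1 : 1 <= r ^+ 2.
Proof.
have Ii (i : 'I_n) : P.-integrable setT (EFin \o (fun w => n%:R^-1 * inner (X w) (tdelta R i) ^+ 2)).
  by apply: integrableRZ; exact: inner_sqr_integrable.
have [_ h] := Rintegral_sum (index_enum 'I_n) Ii.
rewrite -nsq_mean.
have -> : \int[P]_w nsq X w = \int[P]_w (\sum_i n%:R^-1 * inner (X w) (tdelta R i) ^+ 2).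
  apply: eq_Rintegral => w _; rewrite /nsq /inner mulr_suml; apply: eq_bigr => i _.
  by rewrite -/(inner (X w) (tdelta R i)) inner_tdelta mulrC expr2.
rewrite h; apply: (@le_trans _ _ (\sum_(i < n) n%:R^-1 * r ^+ 2)).
  apply: ler_sum => i _; rewrite RintegralZl//; last exact: inner_sqr_integrable.
  apply: ler_wpM2l; first by rewrite invr_ge0.
  apply: le_trans (second_moment_le _) _.
  by rewrite inner_tdelta tnth_mktuple eqxx mulr1.
by rewrite sumr_const card_ord -[X in X <= _]mulr_natl mulVKf// gt_eqF.
Qed.

End finite_M2.

Lemma F_E theta x : F_ X theta x = (\int[P]_w (inner (X w) theta <= x)%R%:R)%:E.
Proof.
have mi : measurable ((fun w => inner (X w) theta) @^-1` `]-oo, x]).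
  rewrite -[Y in measurable Y]setTI.
  by apply: measurable_inner => //; exact: measurable_itv.
have -> : \int[P]_w (inner (X w) theta <= x)%R%:R =
    \int[P]_w (\1_((fun w => inner (X w) theta) @^-1` `]-oo, x]) w : R).
  apply: eq_Rintegral => w _; rewrite -(indic_itvNyE x) !indicE.
  by congr (nat_of_bool _)%:R; apply/idP/idP; rewrite !inE.
by rewrite Rintegral_indic// fineK// fin_num_measure.
Qed.

Lemma sigma2E : sigma2 X = (Num.sqrt n%:R * delta P X)%:E.
Proof.
rewrite /sigma2 /delta EFinM; congr (_ * _)%E; rewrite unlock /Rintegral fineK.
  by apply: eq_integral => w _; rewrite /nsq enorm_sqr.
by apply: integrable_fin_num => //; exact: integrable_delta nsq_integrable.
Qed.

End weighted_sums.

(** * Exchange of theta for H and average over both sources of randomness *)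

Section assembly.
Context (R : realType) (n : nat) (n2 : (2 <= n)%N).
Context (mu : probability (n.-tuple R) R) (unif : uniform_sphere mu).
Context (d : measure_display) (T : measurableType d) (P : probability T R).
Context (X : {RV P >-> n.-tuple R}).
Hypothesis EX : ('E_P[fun w => (enorm (X w) ^+ 2)%R] = n%:R%:E)%E.
Context (d' : measure_display) (W : measurableType d') (G : probability W R).
Context (g : W -> n.-tuple R) (Hg : gaussian_vector G g).

Let n0 : (0 < n)%N. Proof. exact: leq_trans n2. Qed.
Let nR0 : 0 < n%:R :> R. Proof. by rewrite ltr0n. Qed.
Let mX : measurable_fun setT X. Proof. exact: measurable_funPT. Qed.
Let rad := radius (R := R) g.
Let h : n.-tuple R * W -> n.-tuple R := polar g.

(** For positive radius, <X, theta> <= x means <X, H> <= [rad w * x], and rescaling the normal law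
    costs 2 |rad - 1| <= 2 |rad^2 - 1|. For a radius below 1/2 the term 2 |rad^2 - 1| already
    exceeds 1. *)
Lemma cdf_deviation_le (s v beta : R) theta w x : 0 < s -> 0 < v -> 0 < beta ->
  (`|F_ X theta x - Phi x| <= deviation_bound P X h s beta (theta, w) +
   (2 * delta P X + v ^- 2 + 2 * s * v + 2 * `|rad w ^+ 2 - 1|)%:E)%E.
Proof.
move=> s0 v0 b0; rewrite F_E// PhiE -EFinB abse_EFin.
set F := \int[P]_w _.
have D0 := deviation_bound_ge0 P X h s b0 (theta, w).
have d0 : 0 <= delta P X by apply: Rintegral_ge0.
have F01 : 0 <= F <= 1.
  apply/andP; split; first by apply: Rintegral_ge0 => y _; rewrite ler0n.
  rewrite -[leRHS](Rexpectation_cst P); apply: le_Rintegral => //.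
  - apply: (@bounded_integrable _ _ _ P _ 1).
      by apply: measurable_le_indic; exact: measurable_inner.
    by move=> y; case: (_ <= x)%R; rewrite ?normr1 ?normr0.
  - exact: integrable_cstR.
  - by move=> y _; case: (_ <= x)%R.
have l0 : 0 <= rad w by rewrite divr_ge0// sqrtr_ge0.
have rest : 0 <= v ^- 2 + 2 * s * v.
  by rewrite addr_ge0 ?invr_ge0 ?sqr_ge0// mulr_ge0 ?mulr_ge0// ltW.
have [l2|l2] := leP (1 / 2) (rad w); last first.
  apply: (@le_trans _ _ (2 * `|rad w ^+ 2 - 1|)%:E).
    rewrite lee_fin; have := PhiR_ge0 x; have := PhiR_le1 x => ? ?.
    apply: (@le_trans _ _ 1); first by rewrite ler_norml; lra.
    by rewrite ltr0_norm; nra.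
  rewrite -[leLHS]add0e leeD// lee_fin.
  by have := normr_ge0 (rad w ^+ 2 - 1); lra.
have lp : 0 < rad w by lra.
have FE : F = \int[P]_y (inner (X y) (h (theta, w)) <= rad w * x)%R%:R.
  by apply: eq_Rintegral => y _; rewrite inner_tscaler ler_pM2l.
have := @pointwise_bound R n _ T P X _ _ h mX (nsq_integrable EX) (inner_sqr_integrable EX) s v beta
  (theta, w) (rad w * x) s0 v0 b0.
rewrite -FE => hb.
apply: (@le_trans _ _ ((`|F - PhiR (rad w * x)| + `|PhiR (rad w * x) - PhiR x|)%:E)).
  by rewrite lee_fin -[leLHS](_ : `|(F - PhiR (rad w * x)) + (PhiR (rad w * x) - PhiR x)| = _) ?ler_normD//; congr `|_|; ring.
rewrite EFinD [in leRHS]EFinD addeA; apply: leeD => //.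
rewrite lee_fin; apply: (le_trans (PhiR_scale x l2)).
rewrite ler_wpM2l//.
have -> : rad w ^+ 2 - 1 = (rad w - 1) * (rad w + 1) by ring.
by rewrite normrM ler_peMr// ger0_norm; lra.
Qed.

Lemma mean_kolmogorov_le (s v beta : R) (m : nat) : 0 < s -> 0 < v -> 0 < beta ->
  s = 2 ^- m ->
  (forall t, \int[(mu \x G)%E]_y deviation_sq P X h y t <= 66 * Num.min 1 (t ^+ 2) * beta ^+ 2) ->
  (\int[mu]_(theta in sphere R n) kolmogorov_dist (F_ X theta) (@Phi R) <=
   (34 * beta * (1 + 2 * m%:R) +
    (2 * delta P X + v ^- 2 + 2 * s * v + (normal_fourth R + 1) / Num.sqrt n%:R))%:E)%E.
Proof.
move=> s0 v0 b0 sE hV.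
have mh : measurable_fun setT h by exact: measurable_polar Hg.
have sn0 : 0 < Num.sqrt n%:R :> R by rewrite sqrtr_gt0.
have d0 : 0 <= delta P X by apply: Rintegral_ge0.
pose c0 := 2 * delta P X + v ^- 2 + 2 * s * v.
have c00 : 0 <= c0.
  by rewrite /c0 !addr_ge0 ?mulr_ge0 ?invr_ge0 ?sqr_ge0// ltW.
pose K (w : W) := c0 + 2 * `|rad w ^+ 2 - 1|.
have K0 w : 0 <= K w by rewrite addr_ge0// mulr_ge0.
pose D := deviation_bound P X h s beta.
have D0 y : (0 <= D y)%E by exact: deviation_bound_ge0.
have mD : measurable_fun setT D by exact: measurable_deviation_bound.
have mrad : measurable_fun setT rad by exact: measurable_radius Hg.
have mK : measurable_fun setT K.
  apply: measurable_funD => //; apply: measurable_funM => //; apply: measurableT_comp => //.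
  by apply: measurable_funB => //; exact: measurable_funX.
pose V (y : n.-tuple R * W) := (D y + (K y.2)%:E)%E.
have V0 y : (0 <= V y)%E by apply: adde_ge0 => //; rewrite lee_fin.
have mV : measurable_fun setT V.
  apply: emeasurable_funD => //; apply/measurable_EFinP.
  exact: measurableT_comp mK measurable_snd.
have kd0 theta : (0 <= kolmogorov_dist (F_ X theta) (@Phi R))%E.
  apply: (@le_trans _ _ `|F_ X theta 0 - Phi 0|%E); first exact: abse_ge0.
  by apply: ereal_sup_ubound; exists 0.
apply: (@le_trans _ _ (\int[mu]_(theta in sphere R n) \int[G]_w V (theta, w))%E).
  apply: ge0_le_integral_nomeas => theta _ //.
  (* The distance does not depend on w: it is written as its own mean over [G], so that the bound
     applies at each pair (theta, w). *)
  rewrite -[leLHS]mule1 -(@probability_setT _ _ _ G) -integral_cst//.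
  apply: ge0_le_integral_nomeas => w _; first exact: kd0.
  rewrite /kolmogorov_dist /=; apply: ge_ereal_sup => _ [x _ <-].
  exact: cdf_deviation_le.
apply: (@le_trans _ _ (\int[mu]_theta \int[G]_w V (theta, w))%E).
  apply: ge0_subset_integral => //; first exact: measurable_sphere.
    have hF := @measurable_fun_fubini_tonelli_F _ _ _ _ R G _ mV; exact: hF.
  by move=> theta _; exact: integral_ge0.
rewrite -(fubini_tonelli1 _ mV V0) ge0_integralD//; last 2 first.
- by move=> y _; rewrite lee_fin.
- by apply/measurable_EFinP; exact: measurableT_comp mK measurable_snd.
rewrite EFinD; apply: leeD.
  exact: (integral_deviation_bound mX mh b0 sE hV).
(* AM-GM in the form 2 y <= n^-1/2 + n^1/2 y^2 reduces the radial error to the second moment of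
   rad^2 - 1, which is [normal_fourth R / n%:R]. *)
pose K' (w : W) := c0 + (Num.sqrt n%:R)^-1 + Num.sqrt n%:R * (rad w ^+ 2 - 1) ^+ 2.
have KK' w : K w <= K' w.
  rewrite /K -[leRHS]addrA lerD2l.
  rewrite -[(_ - 1) ^+ 2](_ : `|rad w ^+ 2 - 1| ^+ 2 = _); last first.
    by rewrite -normrX ger0_norm// sqr_ge0.
  move: `|_| => y; rewrite -subr_ge0.
  have -> : (Num.sqrt n%:R)^-1 + Num.sqrt n%:R * y ^+ 2 - 2 * y =
      (Num.sqrt n%:R)^-1 * (Num.sqrt n%:R * y - 1) ^+ 2.
    by field; rewrite gt_eqF.
  by rewrite mulr_ge0 ?sqr_ge0// invr_ge0 ltW.
have IK' : G.-integrable setT (EFin \o K').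
  apply: integrableRD; first exact: integrable_cstR.
  by apply: integrableRZ; exact: (integrable_radius_moment Hg n0).
have IK : G.-integrable setT (EFin \o K).
  by apply: (@le_integrableR _ _ _ G _ K') => // w; rewrite ger0_norm.
have I1 : mu.-integrable setT (EFin \o (cst 1 : n.-tuple R -> R)) by exact: integrable_cstR.
have IK2 := integrable_prodM I1 IK.
rewrite (_ : (\int[_]_y _)%E = \int[(mu \x G)%E]_y (cst 1 y.1 * K y.2)%:E)%E; last first.
  by apply: eq_integral => y _; rewrite mul1r.
rewrite -(fineK (integrable_fin_num measurableT IK2)) lee_fin -/(Rintegral _ _ _).
rewrite (Rintegral_prodM I1 IK) /= (Rexpectation_cst mu) mul1r.
apply: (@le_trans _ _ (\int[G]_w K' w)); first by apply: le_Rintegral.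
rewrite RintegralD//; last 2 first.
- exact: integrable_cstR.
- by apply: integrableRZ; exact: (integrable_radius_moment Hg n0).
rewrite (Rexpectation_cst G) RintegralZl//; last exact: (integrable_radius_moment Hg n0).
rewrite (radius_moment Hg n0) -/c0.
have -> : Num.sqrt n%:R * (normal_fourth R / n%:R) = normal_fourth R / Num.sqrt n%:R.
  rewrite -[in LHS](sqr_sqrtr (ltW nR0)) sqrtr_sqr ger0_norm ?sqrtr_ge0//.
  by field; rewrite gt_eqF.
by rewrite mulrDl mul1r; lra.
Qed.

End assembly.

Theorem theorem1p2 (R : realType) :
  exists c : R,
    forall (n : nat), (2 <= n)%N ->
    forall (mu : probability (n.-tuple R) R), uniform_sphere mu ->
    forall (d : measure_display) (T : measurableType d) (P : probability T R)
           (X : {RV P >-> n.-tuple R}),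
      ('E_P[fun w => (enorm (X w) ^+ 2)%R] = n%:R%:E)%E ->
      (\int[mu]_(theta in sphere R n) kolmogorov_dist (F_ X theta) (@Phi R)
       <= c%:E * (M2 X ^+ 2 + sigma2 X) * (ln n%:R / Num.sqrt n%:R)%:E)%E.
Proof.
(* In units of beta ln n: 34 * 10 from the Fourier integral, then 4, 2 and 4 for 2 delta, v^-2 and 2
   s v, and 2 (normal_fourth + 1) for the radius. The last four use 1 <= 2 ln n. *)
exists (352 + 2 * normal_fourth R) => n n2 mu unif d T P X EX.
have N0 : 0 <= normal_fourth R by apply: Rintegral_ge0 => x _; exact: sqr_ge0.
have n0 : (0 < n)%N by exact: leq_trans n2.
have nR0 : 0 < n%:R :> R by rewrite ltr0n.
have sn0 : 0 < Num.sqrt n%:R :> R by rewrite sqrtr_gt0.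
have sn2 : Num.sqrt n%:R ^+ 2 = n%:R :> R by rewrite sqr_sqrtr.
have mX : measurable_fun setT X by exact: measurable_funPT.
have l2 := @ln_nat_ge R n n2.
have LL : 0 < ln n%:R / Num.sqrt n%:R :> R by rewrite divr_gt0//; lra.
set del := delta P X.
have d0 : 0 <= del by apply: Rintegral_ge0.
rewrite (sigma2E EX) -/del.
have [d' [W [G [g Hg]]]] := @gaussian_vector_exists R n.
have St : sphere R n (tdelta R (Ordinal n0)).
  by rewrite /sphere /= /enorm inner_tdelta tnth_mktuple eqxx sqrtr1.
have M20 : (0 <= M2 X)%E.
  apply: le_trans (ereal_sup_ubound _) => /=; last by exists (tdelta R (Ordinal n0)).
  exact: poweR_ge0.
case E2 : (M2 X) M20 => [r| |] //.
  rewrite lee_fin => r0.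
  have M1 := M2_sqr_ge1 n2 EX E2.
  (* beta is (M_2^2 + sigma_2) / sqrt n. Its square dominates M_2^2 / n + delta^2 because M_2^2 <=
     M_2^4. *)
  pose beta := r ^+ 2 / Num.sqrt n%:R + del.
  have b0 : 0 < beta by rewrite ltr_pwDl// divr_gt0//; lra.
  (* The smoothing scale is s = 2^-m <= 1/n, with v = sqrt n. *)
  pose m := up_log 2 n.
  have pm : n%:R <= 2 ^+ m :> R by rewrite -natrX ler_nat; exact: up_logP.
  have pm0 : 0 < 2 ^+ m :> R by rewrite exprn_gt0.
  have s0 : 0 < 2 ^- m :> R by rewrite invr_gt0.
  have hV t : \int[(mu \x G)%E]_y deviation_sq P X (polar g) y t <=
      66 * Num.min 1 (t ^+ 2) * beta ^+ 2.
    rewrite (expectation_deviation_sq n0 P mX (measurable_polar Hg) (polar_char unif Hg)).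
    apply: (le_trans (Rintegral_kernel n0 mX (nsq_integrable EX) (inner_sqr_integrable EX)
      (second_moment_le EX E2) t _ (nsq_mean n2 EX))); first by lra.
    apply: ler_wpM2l; first by rewrite mulr_ge0// min1_ge0.
    rewrite /beta -/del sqrrD exprMn exprVn sn2.
    have q0 : 0 <= r ^+ 2 / Num.sqrt n%:R * del by rewrite mulr_ge0// divr_ge0 ?sqr_ge0// ltW.
    have : r ^+ 2 / n%:R <= (r ^+ 2) ^+ 2 / n%:R by rewrite ler_pM2r ?invr_gt0//; nra.
    by move: q0; rewrite mulr2n; lra.
  have key := @mean_kolmogorov_le R n n2 mu _ T P X EX _ W G g Hg _ _ _ m s0 sn0 b0 erefl hV.
  apply: le_trans key _.
  rewrite -EFin_expe -EFinD -!EFinM lee_fin -/del.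
  have -> : (352 + 2 * normal_fourth R) * (r ^+ 2 + Num.sqrt n%:R * del) * (ln n%:R / Num.sqrt n%:R) =
      (352 + 2 * normal_fourth R) * beta * ln n%:R.
    by rewrite /beta; field; rewrite gt_eqF.
  have h1 := @up_log_le R n n2; rewrite -/m in h1.
  have i0 : 0 < (Num.sqrt n%:R)^-1 :> R by rewrite invr_gt0.
  have h2 : (Num.sqrt n%:R)^-1 <= beta.
    rewrite /beta -[leLHS]addr0 lerD//; rewrite -[leLHS]mul1r ler_wpM2r//; lra.
  have h3 : del <= beta by rewrite /beta lerDr divr_ge0 ?sqr_ge0// ltW.
  have s1 : 1 <= Num.sqrt n%:R :> R.
    by rewrite -[leLHS]sqrtr1 ler_wsqrtr// ler1n.
  have h4 : Num.sqrt n%:R ^- 2 <= (Num.sqrt n%:R)^-1 :> R.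
    by rewrite lef_pV2 ?posrE ?exprn_gt0// expr2 ler_peMr// ltW.
  have h5 : 2 * 2 ^- m * Num.sqrt n%:R <= 2 * (Num.sqrt n%:R)^-1 :> R.
    rewrite -mulrA ler_pM2l//.
    have -> : (Num.sqrt n%:R)^-1 = n%:R^-1 * Num.sqrt n%:R :> R.
      transitivity ((Num.sqrt n%:R ^+ 2)^-1 * Num.sqrt n%:R : R); last by rewrite sn2.
      by field; rewrite gt_eqF.
    by rewrite ler_pM2r// lef_pV2.
  have k1 : 34 * beta * (1 + 2 * m%:R) <= 34 * beta * (10 * ln n%:R).
    by rewrite ler_pM2l// mulr_gt0.
  have k2 : beta <= 2 * (beta * ln n%:R) by nra.
  have k3 : (normal_fourth R + 1) / Num.sqrt n%:R <= (normal_fourth R + 1) * (2 * (beta * ln n%:R)).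
    by rewrite ler_wpM2l//; lra.
  by lra.
(* For infinite M_2 the right side is +oo, since the constant and ln n / sqrt n are strictly
   positive. *)
move=> _; rewrite [leRHS](_ : _ = +oo%E) ?leey//.
rewrite expe2 mulyy addye// gt0_muley ?lte_fin//; last by lra.
by rewrite gt0_mulye ?lte_fin.
Qed.
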